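(* Let $y\in\mathbb{R}$, $\beta>0$, and let $\tau_y=(\tau_{y,1},\tau_{y,2})$ be the first hitting point of the level $y$ by the Brownian sheet $B$ (i.e. $B(\tau_y)=y$ a.s.). Then $$\mathbb{E}\left[e^{-\frac12\beta^2\tau_{y,1}\tau_{y,2}}\right]=e^{-\beta|y|}.$$
   Context: $B=\{B(t,x): t,x\ge 0\}$ is a Brownian sheet on a complete probability space, i.e. a centered Gaussian field with $\mathbb{E}[B(t,x)B(s,y)]=(t\wedge s)(x\wedge y)$. $\{\mathcal{F}_{t,x}\}$ is the completed filtration generated by it: $\mathcal{F}_{t,x}$ is generated by $\{B(r,a):0\le r\le t,\ 0\le a\le x\}$. A stopping point is a random variable $\tau=(\tau_1,\tau_2)$ with values in $\mathbb{R}_+\times\mathbb{R}_+$ (components may also take the value $\infty$) such that $\{\tau_1\le t,\ \tau_2\le x\}\in\mathcal{F}_{t,x}$ for all $(t,x)\in\mathbb{R}_+^2$. A first hitting point for the level $y$ is a stopping point $\tau$ such that $B(\tau)=y$ a.s. and $B(z)\ne y$ for all $z\le\tau$, $z\ne\tau$, where $\le$ on $\mathbb{R}_+^2$ is the coordinatewise order.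
   Formalization: The Brownian sheet is taken to have almost surely continuous paths, which the stated Gaussian and covariance definition alone does not give and without which the claim fails for irregular modifications. *)

(* Defs.v *)
From HB Require Import structures.
From mathcomp Require Import all_boot all_order all_algebra.
From mathcomp Require Import all_classical all_reals all_analysis measurable_realfun.

Set Implicit Arguments.
Unset Strict Implicit.
Unset Printing Implicit Defensive.

Import Order.TTheory GRing.Theory Num.Theory.
Import numFieldNormedType.Exports.

Local Open Scope classical_set_scope.
Local Open Scope ring_scope.

(* Degenerate laws are Gaussian too: the case s = 0 is the Dirac mass at m.
   It is separated because [normal_prob m 0] is the uniform law on [0, 1]. *)
Definition gaussian_law d (T : measurableType d) (R : realType)
    (P : probability T R) (X : T -> R) : Prop :=
  exists m s : R, 0 <= s /\
    forall U : set R, measurable U ->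
      pushforward P X U = (if s == 0 then \d_m U else normal_prob m s U).

Definition quadrant (R : realType) : set (R * R) :=
  [set z | 0 <= z.1 /\ 0 <= z.2].

(* A field is a family indexed by R * R of which only the part indexed by
   [quadrant] matters. *)
Definition gaussian_field d (T : measurableType d) (R : realType)
    (P : probability T R) (B : R * R -> {RV P >-> R}) : Prop :=
  forall (n : nat) (z : 'I_n -> R * R) (c : 'I_n -> R),
    (forall i, quadrant (z i)) ->
    gaussian_law P (fun w => \sum_(i < n) c i * B (z i) w).

(* As usual, the sheet has (almost surely) continuous paths; the covariance
   alone does not determine the path properties that hitting points involve. *)
Definition brownian_sheet d (T : measurableType d) (R : realType)
    (P : probability T R) (B : R * R -> {RV P >-> R}) : Prop :=
  [/\ gaussian_field B,
      forall z, quadrant z -> ('E_P[B z] = 0)%E,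
      forall z z', quadrant z -> quadrant z' ->
        ('E_P[fun w => (B z w * B z' w)%R] =
          (Num.min z.1 z'.1 * Num.min z.2 z'.2)%:E)%E
    & {ae P, forall w, {within @quadrant R, continuous (fun z => B z w)}}].

Definition sheet_filtration d (T : measurableType d) (R : realType)
    (P : probability T R) (B : R * R -> {RV P >-> R}) (t x : R) :
    set (set T) :=
  <<s P.-negligible `|`
      \bigcup_(z in [set z | (0 <= z.1 <= t) && (0 <= z.2 <= x)])
        preimage_set_system [set: T] (B z) measurable >>.

Definition stopping_point d (T : measurableType d) (R : realType)
    (P : probability T R) (B : R * R -> {RV P >-> R})
    (tau : {RV P >-> (\bar R * \bar R)%type}) : Prop :=
  (forall w, (0 <= (tau w).1)%E /\ (0 <= (tau w).2)%E) /\
  (forall t x : R, 0 <= t -> 0 <= x ->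
    sheet_filtration B t x
      [set w | ((tau w).1 <= t%:E)%E /\ ((tau w).2 <= x%:E)%E]).

(* [B] is only defined at finite points, so B(tau) = y almost surely includes
   the almost sure finiteness of both components of tau. *)
Definition first_hitting_point d (T : measurableType d) (R : realType)
    (P : probability T R) (B : R * R -> {RV P >-> R}) (y : R)
    (tau : {RV P >-> (\bar R * \bar R)%type}) : Prop :=
  [/\ stopping_point B tau,
      {ae P, forall w, exists2 z : R * R,
        tau w = (z.1%:E, z.2%:E) & B z w = y}
    & {ae P, forall w, forall z : R * R, quadrant z ->
        (z.1%:E <= (tau w).1)%E -> (z.2%:E <= (tau w).2)%E ->
        (z.1%:E, z.2%:E) <> tau w -> B z w <> y}].

(* Main.v *)
Require Import Defs.
From HB Require Import structures.
From mathcomp Require Import all_boot all_order all_algebra.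
From mathcomp Require Import all_classical all_reals all_analysis measurable_realfun.
From mathcomp Require Import zify ring lra.

Import Order.TTheory GRing.Theory Num.Theory.
Import numFieldNormedType.Exports.

Local Open Scope classical_set_scope.
Local Open Scope ring_scope.

Set Implicit Arguments.
Unset Strict Implicit.
Unset Printing Implicit Defensive.

(** Let [c = beta] or [c = - beta], the sign being that of [y]. For every [z],
[exp (c B z - c^2 z_1 z_2 / 2)] is a two-parameter martingale. Discretise
[tau] upwards on a grid of mesh [h]. The events "tau lies straight above the
grid point [p]" and "tau lies straight to the right of [p]" are disjoint and,
the increments of [B] over disjoint rectangles being independent,
conditionally independent given the past [F_p] of [p]; hence some event of
[F_p] separates them. Using it to choose between going up and going right
gives an increasing grid path whose steps are decided by the past and which
passes through the discretised [tau], unless it leaves the square [[0, N]^2]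
before. Stopping the martingale at the end of the path, a point below the
discretised [tau], preserves its expectation 1. Before [tau] the martingale is
bounded by [exp (c y)], because [c B <= c y] there, so that the paths which
leave the square contribute a negligible amount as [h -> 0] and then [N ->
oo], and [E exp (c y - c^2 tau_1 tau_2 / 2) = 1].

Gaussian independence is only known through the laws of linear combinations.
It is recovered from the uniqueness of finite moment generating functions: the
bounded functions [g] such that multiplication by [g] preserves the equality
of two moment generating functions form an algebra which contains [sin (a (X -
v))], and iterating a polynomial on it produces the indicators of half-lines.
*)

(** * Elementary limits *)

Section real_facts.
Variable R : realType.
Implicit Types x s : R.

Lemma expR_sub1_le x : expR x - 1 <= x * expR x.
Proof.
have := expR_ge1Dx (- x); rewrite expRN; have := expR_gt0 x.
set e := expR x => e0 h1.
have : (1 - x) * e <= e^-1 * e by rewrite ler_wpM2r // ltW.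
by rewrite mulVf ?gt_eqF//; lra.
Qed.

Lemma norm_expR_sub1 x : `|expR x - 1| <= `|x| * expR `|x|.
Proof.
have h1 := expR_ge1Dx x; have h3 := expR_sub1_le x.
have [x0|x0] := leP 0 x.
  by rewrite (ger0_norm x0) ger0_norm; lra.
have e1 : expR x <= 1 by rewrite expR_le1 ltW.
rewrite (ltr0_norm x0) (ler0_norm (_ : expR x - 1 <= 0)); last lra.
have : 1 <= expR (- x) by rewrite expRN invf_ge1 ?expR_gt0.
nra.
Qed.

Lemma expR_norm_le x : expR `|x| <= expR x + expR (- x).
Proof.
by case: (ger0P x) => _; rewrite ?lerDl ?lerDr ?expR_ge0.
Qed.

Lemma norm_le_expR x : `|x| <= expR `|x|.
Proof. by have := expR_ge1Dx `|x|; lra. Qed.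

(** Difference quotient at 0 of [t -> expR (t * x)], with increment [1 / (n + 1)]. Its limit [x] is
    thus reached from exponentials of multiples of [x] and constants. *)
Definition expR_slope x (n : nat) : R := n.+1%:R * (expR (x / n.+1%:R) - 1).

Lemma norm_div_le x n : `|x / n.+1%:R| <= `|x|.
Proof.
rewrite normrM normfV (ger0_norm (ler0n _ _)) ler_pdivrMr// ler_peMr//.
by rewrite ler1n.
Qed.

(** From [|x| * expR |x| <= expR (2 |x|)]. The bound is uniform in [n] and is itself made of
    exponentials, as domination by exponential weights will require. *)
Lemma norm_expR_slope x n : `|expR_slope x n| <= expR (2 * x) + expR (- (2 * x)).
Proof.
apply: (@le_trans _ _ (expR `|2 * x|)); last exact: expR_norm_le.
apply: (@le_trans _ _ (`|x| * expR `|x|)).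
  rewrite /expR_slope normrM (ger0_norm (ler0n _ _)).
  apply: (@le_trans _ _ (n.+1%:R * (`|x / n.+1%:R| * expR `|x / n.+1%:R|))).
    by rewrite ler_wpM2l// norm_expR_sub1.
  rewrite mulrA; apply: ler_pM; rewrite ?expR_ge0 ?mulr_ge0//.
    by rewrite normrM normfV (ger0_norm (ler0n _ _)) mulrCA divff// mulr1.
  by rewrite ler_expR norm_div_le.
rewrite normrM ger0_norm// mulr_natl mulr2n expRD ler_wpM2r ?expR_ge0//.
exact: norm_le_expR.
Qed.

Lemma cvg_expR_slope x : expR_slope x n @[n --> \oo] --> x.
Proof.
have b n : `|expR_slope x n - x| <= x ^+ 2 * expR `|x| * n.+1%:R^-1.
  have -> : expR_slope x n - x =
      n.+1%:R * (expR (x / n.+1%:R) - 1 - x / n.+1%:R).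
    by rewrite /expR_slope; field.
  set t := x / n.+1%:R.
  have h1 := expR_ge1Dx t; have h2 := expR_sub1_le t.
  rewrite normrM (ger0_norm (ler0n _ _)) ger0_norm; last lra.
  have h3 : expR t - 1 - t <= `|t| * (`|t| * expR `|t|).
    apply: (@le_trans _ _ (`|t| * `|expR t - 1|)); last first.
      by rewrite ler_wpM2l// norm_expR_sub1.
    by rewrite -normrM; apply: le_trans (ler_norm _); lra.
  apply: (@le_trans _ _ (n.+1%:R * (`|t| * (`|t| * expR `|t|)))).
    by rewrite ler_wpM2l.
  have -> : x ^+ 2 * expR `|x| / n.+1%:R =
      n.+1%:R * (`|t| * (`|t| * expR `|x|)).
    rewrite (mulrA `|t|) -expr2 real_normK ?num_real// /t; field.
    by rewrite nat1r pnatr_eq0.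
  do 3!apply: ler_wpM2l => //.
  by rewrite ler_expR norm_div_le.
apply/subr_cvg0/norm_cvg0P.
apply: (@squeeze_cvgr _ _ _ _ (fun=> 0) (fun n => x ^+ 2 * expR `|x| * n.+1%:R^-1)).
- by apply: nearW => n; rewrite normr_ge0/= b.
- exact: cvg_cst.
- by rewrite -[X in _ --> X](mulr0 (x ^+ 2 * expR `|x|)); apply: cvgMr; exact: cvg_harmonic.
Qed.

(** Termwise comparison with the exponential series at [|x|], whose partial sums increase to their
    limit. *)
Lemma norm_series_sin_coeff x n : `|series (sin_coeff x) n| <= expR `|x|.
Proof.
apply: (@le_trans _ _ (series (exp_coeff `|x|) n)).
  rewrite /series/=; apply: (le_trans (ler_norm_sum _ _ _)).
  apply: ler_sum => k _; rewrite /sin_coeff /exp_coeff/=.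
  rewrite !normrM normfV !(ger0_norm (ler0n _ _)) !normrX normrN1 expr1n mulr1.
  rewrite ler_wpM2r ?invr_ge0// ler_piMl ?exprn_ge0//.
  by case: odd.
apply: nondecreasing_cvgn_le; last exact: is_cvg_series_exp_coeff.
apply/nondecreasing_seqP => k; rewrite !seriesEnat/= big_nat_recr//= lerDl.
by rewrite /exp_coeff/= divr_ge0// exprn_ge0.
Qed.

Lemma cvg_series_sin_coeff x : series (sin_coeff x) n @[n --> \oo] --> sin x.
Proof. by rewrite unlock; exact: is_cvg_series_sin_coeff. Qed.

(* [s] moves monotonically to its sign under this map. *)
Definition sharpen s : R := (3 * s - s ^+ 3) / 2.

Lemma sharpenN s : sharpen (- s) = - sharpen s.
Proof. by rewrite /sharpen; field. Qed.

Lemma sharpen_bound s : 0 <= s <= 1 -> s <= sharpen s <= 1.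
Proof.
move=> /andP[s0 s1]; rewrite -subr_ge0 -[X in _ && X]subr_ge0 /sharpen.
have -> : (3 * s - s ^+ 3) / 2 - s = s * (1 - s) * (1 + s) / 2 by field.
have -> : 1 - (3 * s - s ^+ 3) / 2 = (1 - s) ^+ 2 * (s + 2) / 2 by field.
by rewrite !divr_ge0 ?mulr_ge0 ?sqr_ge0 ?subr_ge0// addr_ge0.
Qed.

Lemma iter_sharpenN n s : iter n sharpen (- s) = - iter n sharpen s.
Proof. by elim: n => //= n ->; rewrite sharpenN. Qed.

Lemma iter_sharpen_bound n s : 0 <= s <= 1 -> s <= iter n sharpen s <= 1.
Proof.
move=> /andP[s0 s1]; elim: n => [|n /andP[ih1 ih2]]/=; first by rewrite lexx.
have /sharpen_bound/andP[h1 h2] : 0 <= iter n sharpen s <= 1.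
  by rewrite ih2 (le_trans s0).
by rewrite h2 (le_trans ih1).
Qed.

Lemma norm_iter_sharpen n s : `|s| <= 1 -> `|iter n sharpen s| <= 1.
Proof.
wlog s0 : s / 0 <= s => [h|].
  have [|/ltW s0 s1] := leP 0 s; first exact: h.
  by rewrite -(opprK s) iter_sharpenN normrN h ?normrN// oppr_ge0.
rewrite ger0_norm// => s1.
have /(iter_sharpen_bound n)/andP[h1 h2] : 0 <= s <= 1 by rewrite s0.
by rewrite ger0_norm// (le_trans s0 h1).
Qed.

(** For [s > 0] the iterates increase and stay in [[s, 1]]. Their limit [l] is a fixed point, so
    [l * (1 - l ^+ 2) = 0] with [l >= s > 0], which leaves [l = 1]. Oddness gives the negative
    case. *)
Lemma cvg_iter_sharpen s : `|s| <= 1 -> iter n sharpen s @[n --> \oo] --> Num.sg s.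
Proof.
wlog s0 : s / 0 < s => [h|].
  case: (ltrgtP s 0) => [s0 s1|s0 s1|-> _]; last 1 first.
  - rewrite sgr0; under eq_fun => n.
      have -> : iter n sharpen 0 = 0.
        by elim: n => //= n ->; rewrite /sharpen expr0n/= mulr0 subrr mul0r.
      over.
    exact: cvg_cst.
  - rewrite -(opprK s); under eq_fun do rewrite iter_sharpenN.
    by rewrite sgrN; apply: cvgN; apply: h; rewrite ?normrN// oppr_gt0.
  - exact: h.
rewrite gtr0_norm// gtr0_sg// => s1.
have b n : s <= iter n sharpen s <= 1 by apply: iter_sharpen_bound; rewrite (ltW s0).
have cv : cvgn (fun n => iter n sharpen s).
  apply: nondecreasing_is_cvgn.
    apply/nondecreasing_seqP => n /=.
    by have /andP[h1 h2] := b n; have /sharpen_bound/andP[] : 0 <= iter n sharpen s <= 1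
       by rewrite h2 (le_trans (ltW s0)).
  by exists 1 => _ [n _ <-]; have /andP[] := b n.
have := cv; set l := limn _ => cvl.
have sl : s <= l by apply: limr_ge => //; apply: nearW => n; have /andP[] := b n.
have cvS : (fun n => iter n.+1 sharpen s) @ \oo --> l.
  by have := cvl; rewrite -cvg_shiftS.
have cvS' : (fun n => iter n.+1 sharpen s) @ \oo --> sharpen l.
  rewrite /= /sharpen; apply: cvgMl; apply: cvgB; first exact: cvgMr.
  exact: (cvg_comp _ _ cvl (@exprn_continuous R 3 l)).
have e : l = sharpen l by apply: (cvg_unique _ cvS cvS').
suff <- : l = 1 by [].
have : l * (1 - l ^+ 2) = 0.
  have : sharpen l - l = 0 by rewrite -e subrr.
  by rewrite /sharpen; lra.
move/eqP; rewrite mulf_eq0 => /orP[/eqP l0|]; first by move: sl; rewrite l0; lra.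
rewrite subr_eq0 eq_sym sqrf_eq1 => /orP[/eqP//|/eqP l1].
by move: sl; rewrite l1; lra.
Qed.

(** The sequence is eventually constant: once [|x| / (n + 1) < pi], the sine has the sign of [x]. *)
Lemma cvg_sg_sin x : Num.sg (sin (x / n.+1%:R)) @[n --> \oo] --> Num.sg x.
Proof.
wlog x0 : x / 0 < x => [h|].
  case: (ltrgtP x 0) => [x0|x0|->]; last 1 first.
  - by under eq_fun do rewrite mul0r sin0; exact: cvg_cst.
  - rewrite -(opprK x); under eq_fun do rewrite mulNr sinN sgrN.
    by rewrite sgrN; apply: cvgN; apply: h; rewrite oppr_gt0.
  - exact: h.
rewrite gtr0_sg//; apply: cvg_near_cst; near=> n.
rewrite gtr0_sg// sin_gt0_pi// divr_gt0//=.
rewrite ltr_pdivrMr// -ltr_pdivrMl ?pi_gt0//.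
near: n; exists (Num.truncn (pi^-1 * x)).+1 => // n /= hn.
rewrite (lt_le_trans (truncnS_gt _))// ler_nat.
by rewrite (leq_trans hn).
Unshelve. all: by end_near. Qed.

End real_facts.

(** * Uniqueness of moment generating functions *)

Section mgf_uniqueness.
Context d (T : measurableType d) (R : realType).
Variables mu nu : {finite_measure set T -> \bar R}.
Variable S : set (T -> R).
Hypothesis S0 : S (fun=> 0).
Hypothesis SD : forall f g, S f -> S g -> S (fun w => f w + g w).
Hypothesis SZ : forall a f, S f -> S (fun w => a * f w).
Hypothesis mS : forall f, S f -> measurable_fun [set: T] f.
Hypothesis mgf_fin : forall f, S f -> (\int[mu]_w (expR (f w))%:E < +oo)%E.
Hypothesis mgf_eq : forall f, S f ->
  (\int[mu]_w (expR (f w))%:E = \int[nu]_w (expR (f w))%:E)%E.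

Implicit Types (f g X L : T -> R) (m : {measure set T -> \bar R}).

Let tame (m : set T -> \bar R) (g : T -> R) := measurable_fun [set: T] g /\
  forall L, S L -> m.-integrable setT (fun w => (g w * expR (L w))%:E).

Let mexp f : S f -> measurable_fun [set: T] (fun w => expR (f w)).
Proof. by move=> Sf; apply: measurableT_comp => //; exact: mS. Qed.

Let tame_le m f g : measurable_fun [set: T] f ->
  (forall w, `|f w| <= g w) -> tame m g -> tame m f.
Proof.
move=> mf fg [mg tg]; split => // L SL; apply: (le_integrable _ _ _ (tg _ SL)) => //.
  by apply/measurable_EFinP/measurable_funM => //; exact: mexp.
move=> w _; rewrite !abse_EFin lee_fin !normrM ler_wpM2r//.
by rewrite (le_trans (fg _))// ler_norm.
Qed.

Let tame_abs m f : tame m f -> tame m (fun w => `|f w|).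
Proof.
move=> [mf tf]; split; first exact: measurableT_comp.
move=> L SL; apply: (le_integrable _ _ _ (tf _ SL)) => //.
  by apply/measurable_EFinP/measurable_funM; [exact: measurableT_comp|exact: mexp].
by move=> w _; rewrite !abse_EFin lee_fin !normrM normr_id.
Qed.

Let tameD m f g : tame m f -> tame m g ->
  tame m (fun w => f w + g w).
Proof.
move=> [mf tf] [mg tg]; split; first exact: measurable_funD.
move=> L SL; under eq_fun do rewrite mulrDl EFinD.
by apply: integrableD => //; [exact: tf|exact: tg].
Qed.

Let tameZ m a f : tame m f -> tame m (fun w => a * f w).
Proof.
move=> [mf tf]; split; first exact: measurable_funM.
move=> L SL; under eq_fun do rewrite -mulrA EFinM.
by apply: integrableZl => //; exact: tf.
Qed.

Let tame_exp m X f : S X -> tame m f ->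
  tame m (fun w => expR (X w) * f w).
Proof.
move=> SX [mf tf]; split; first by apply: measurable_funM => //; exact: mexp.
move=> L SL; under eq_fun do rewrite (mulrC (expR _)) -mulrA -expRD.
by apply: tf; exact: SD.
Qed.

(** The signed measures of density [f] with respect to [mu] and [nu] have the same finite moment
    generating function on [S]. *)
Let good f := [/\ tame mu f, tame nu f & forall L, S L ->
  (\int[mu]_w (f w * expR (L w))%:E = \int[nu]_w (f w * expR (L w))%:E)%E].

Let good1 : good (fun=> 1).
Proof.
split=> [||L SL]; [split=> // L SL..|by under eq_integral do rewrite mul1r;
  under [RHS]eq_integral do rewrite mul1r; exact: mgf_eq].
- apply/integrableP; split.
    by apply/measurable_EFinP/measurable_funM => //; exact: mexp.
  under eq_integral do rewrite abse_EFin mul1r ger0_norm ?expR_ge0//.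
  exact: mgf_fin.
- apply/integrableP; split.
    by apply/measurable_EFinP/measurable_funM => //; exact: mexp.
  under eq_integral do rewrite abse_EFin mul1r ger0_norm ?expR_ge0//.
  by rewrite -mgf_eq//; exact: mgf_fin.
Qed.

(** Dominated convergence under [mu] and under [nu], against each exponential weight. *)
Let good_lim (f_ : nat -> T -> R) f g : (forall n, good (f_ n)) ->
  tame mu g -> tame nu g -> (forall n w, `|f_ n w| <= g w) ->
  (forall w, f_ n w @[n --> \oo] --> f w) -> good f.
Proof.
move=> gf tmu tnu fg f_f.
have mf : measurable_fun setT f.
  apply: (@measurable_fun_cvg _ T R setT f_ f); last by move=> w _; exact: f_f.
  by move=> n; have [[]] := gf n.
have fg' w : `|f w| <= g w.
  have /cvg_norm h := f_f w; rewrite -(cvg_lim _ h)//.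
  apply: limr_le; first exact: cvgP h.
  by apply: nearW.
have ilim m : tame m g -> forall L, S L ->
    (\int[m]_w (f_ n w * expR (L w))%:E @[n --> \oo] --> \int[m]_w (f w * expR (L w))%:E)%E.
  move=> tg L SL.
  have [] := @dominated_convergence _ _ _ m setT measurableT
    (fun n w => (f_ n w * expR (L w))%:E) (fun w => (f w * expR (L w))%:E)
    (fun w => (g w * expR (L w))%:E) => //.
  - move=> n; apply/measurable_EFinP/measurable_funM; last exact: mexp.
    by have [[]] := gf n.
  - by apply/measurable_EFinP/measurable_funM => //; exact: mexp.
  - apply: aeW => w _; apply: cvg_EFin; first by apply: nearW.
    by apply: cvgMl; exact: f_f.
  - exact: tg.2.
  - apply: aeW => w n _; rewrite abse_EFin lee_fin normrM (ger0_norm (expR_ge0 _)).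
    by rewrite ler_wpM2r ?expR_ge0.
split; [exact: tame_le tmu|exact: tame_le tnu|move=> L SL].
have h1 := ilim _ tmu _ SL; have h2 := ilim _ tnu _ SL.
rewrite -(cvg_lim _ h1)// -(cvg_lim _ h2)//; congr (lim (_ @ \oo)).
by apply/funext => n; have [_ _ ->] := gf n.
Qed.

Let goodD f g : good f -> good g -> good (fun w => f w + g w).
Proof.
move=> [fmu fnu fe] [gmu gnu ge]; split; [exact: tameD|exact: tameD|move=> L SL].
under eq_integral do rewrite mulrDl EFinD.
under [RHS]eq_integral do rewrite mulrDl EFinD.
rewrite !integralD//; [|exact: fnu.2|exact: gnu.2|exact: fmu.2|exact: gmu.2].
by rewrite fe// ge.
Qed.

Let goodZ a f : good f -> good (fun w => a * f w).
Proof.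
move=> [fmu fnu fe]; split; [exact: tameZ|exact: tameZ|move=> L SL].
under eq_integral do rewrite -mulrA EFinM.
under [RHS]eq_integral do rewrite -mulrA EFinM.
by rewrite !integralZl//; [rewrite fe|exact: fnu.2|exact: fmu.2].
Qed.

Let good_exp X f : S X -> good f -> good (fun w => expR (X w) * f w).
Proof.
move=> SX [fmu fnu fe]; split; [exact: tame_exp|exact: tame_exp|move=> L SL].
under eq_integral do rewrite (mulrC (expR _)) -mulrA -expRD.
under [RHS]eq_integral do rewrite (mulrC (expR _)) -mulrA -expRD.
by apply: fe; exact: SD.
Qed.

(** Unlike the [good] functions, the multipliers are visibly closed under products, so polynomials
    in a multiplier are available before limits are taken. *)
Let multiplier g := forall f, good f -> good (fun w => g w * f w).

Let mult_cst a : multiplier (fun=> a).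
Proof. by move=> f; exact: goodZ. Qed.

Let multD f g : multiplier f -> multiplier g -> multiplier (fun w => f w + g w).
Proof.
move=> mf mg h gh; under eq_fun do rewrite mulrDl.
by apply: goodD; [exact: mf|exact: mg].
Qed.

Let multM f g : multiplier f -> multiplier g -> multiplier (fun w => f w * g w).
Proof.
move=> mf mg h gh; under eq_fun do rewrite -mulrA.
by apply: mf; exact: mg.
Qed.

Let multZ a f : multiplier f -> multiplier (fun w => a * f w).
Proof. by apply: multM; exact: mult_cst. Qed.

Let multX f n : multiplier f -> multiplier (fun w => f w ^+ n).
Proof.
move=> mf; elim: n => [|n ih]; first exact: mult_cst.
by under eq_fun do rewrite exprS; exact: multM.
Qed.

Let mult_sum (f_ : nat -> T -> R) n : (forall k, multiplier (f_ k)) ->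
  multiplier (fun w => \sum_(0 <= k < n) f_ k w).
Proof.
move=> mf; elim: n => [|n ih].
  by under eq_fun do rewrite big_nil; exact: mult_cst.
by under eq_fun do rewrite big_nat_recr//=; exact: multD.
Qed.

Let mult_lim (g_ : nat -> T -> R) g X a : S X -> (forall n, multiplier (g_ n)) ->
  (forall n w, `|g_ n w| <= a * (expR (X w) + expR (- X w))) ->
  (forall w, g_ n w @[n --> \oo] --> g w) -> multiplier g.
Proof.
move=> SX mg gb gl f gf.
have SNX : S (fun w => - X w).
  by under eq_fun do rewrite -mulN1r; exact: SZ.
pose h w := a * (expR (X w) * `|f w| + expR (- X w) * `|f w|).
have th m : tame m f -> tame m h.
  by move=> tf; apply: tameZ; apply: tameD; apply: tame_exp => //; exact: tame_abs.
have [tmu tnu _] := gf.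
apply: (@good_lim (fun n w => g_ n w * f w) _ h) => [n||||].
- exact: mg.
- exact: th.
- exact: th.
- move=> n w; rewrite normrM /h -mulrDl mulrA ler_wpM2r//.
- by move=> w; apply: cvgMl; exact: gl.
Qed.

Let mult_bounded_lim (g_ : nat -> T -> R) g : (forall n, multiplier (g_ n)) ->
  (forall n w, `|g_ n w| <= 1) ->
  (forall w, g_ n w @[n --> \oo] --> g w) -> multiplier g.
Proof.
move=> mg gb; apply: (@mult_lim _ _ (fun=> 0) 1) => // n w.
by rewrite oppr0 expR0 mul1r (le_trans (gb _ _))// lerDl.
Qed.

Let mult_lin X : S X -> multiplier X.
Proof.
move=> SX; apply: (@mult_lim (fun n w => expR_slope (X w) n) _ (fun w => 2 * X w) 1).
- exact: SZ.
- move=> n; apply: multZ; apply: multD; last exact: mult_cst.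
  move=> f; apply: good_exp; under eq_fun do rewrite mulrC.
  exact: SZ.
- by move=> n w; rewrite mul1r norm_expR_slope.
- by move=> w; exact: cvg_expR_slope.
Qed.

(** The partial sums of the sine series are polynomials in [X], dominated by [expR |a v|] times the
    two exponentials of [a * X] and [- a * X]. *)
Let mult_sin X a v : S X -> multiplier (fun w => sin (a * (X w - v))).
Proof.
move=> SX; pose Y w := a * (X w - v).
have mY : multiplier Y.
  by apply: multZ; apply: multD; [exact: mult_lin|exact: mult_cst].
apply: (@mult_lim (fun n w => series (sin_coeff (Y w)) n) _
   (fun w => a * X w) (expR `|a * v|)).
- exact: SZ.
- move=> n; rewrite /series/=; apply: mult_sum => k.
  rewrite /sin_coeff/=.
  under eq_fun do rewrite -mulrA (mulrC (_ ^+ _)) mulrA.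
  by apply: multZ; exact: multX.
- move=> n w; apply: (le_trans (norm_series_sin_coeff _ _)).
  apply: (@le_trans _ _ (expR (`|a * X w| + `|a * v|))).
    by rewrite ler_expR /Y mulrBr (le_trans (ler_normB _ _)).
  by rewrite expRD mulrC ler_wpM2l ?expR_ge0// expR_norm_le.
- by move=> w; exact: cvg_series_sin_coeff.
Qed.

(** Iterating [sharpen] needs an argument in [[-1, 1]], hence the passage through the sine: the
    inner limit gives the sign of [sin ((X w - v) / (n + 1))], the outer one the sign of
    [X w - v]. *)
Let mult_sg X v : S X -> multiplier (fun w => Num.sg (X w - v)).
Proof.
move=> SX; apply: (@mult_bounded_lim
  (fun n w => Num.sg (sin ((X w - v) / n.+1%:R)))) => [n|n w|w].
- apply: (@mult_bounded_lim
    (fun k w => iter k (@sharpen R) (sin ((X w - v) / n.+1%:R)))) => [k|k w|w].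
  + elim: k => [|k ih] /=; first by under eq_fun do rewrite mulrC; exact: mult_sin.
    under eq_fun do rewrite /sharpen mulrC -(mulN1r (_ ^+ 3)).
    apply: multZ; apply: multD; first exact: multZ.
    by apply: multZ; exact: multX.
  + exact/norm_iter_sharpen/sin_max.
  + exact/cvg_iter_sharpen/sin_max.
- by case: sgrP => _; rewrite ?normr0 ?normrN1 ?normr1.
- exact: cvg_sg_sin.
Qed.

Let mult_gt X (v : R) : S X -> multiplier (fun w => (v < X w)%R%:R).
Proof.
move=> SX; have h := mult_sg v SX.
rewrite (_ : (fun w => _) = fun w =>
    2^-1 * (Num.sg (X w - v) * Num.sg (X w - v) + Num.sg (X w - v))).
  by apply: multZ; apply: multD => //; exact: multM.
apply/funext => w; rewrite -(subr_gt0 v).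
by case: sgrP => _ /=; rewrite ?ltxx//; field.
Qed.

Let gen := [set A | measurable A /\ multiplier (fun w => (w \in A)%:R)].

Let gen_eq A : gen A -> mu A = nu A.
Proof.
move=> [mA gA]; have [_ _ /(_ _ S0)] := gA _ good1.
under eq_integral do rewrite expR0 !mulr1.
under [RHS]eq_integral do rewrite expR0 !mulr1.
by rewrite !integral_indic// !setIT.
Qed.

(** The measurable sets whose indicator is a multiplier form a pi-system containing every
    [[set w | x < f w]] with [f] in [S]. Both measures agree on it, as seen by taking [f = 1] and
    [L = 0] in [good], hence also on the generated sigma-algebra. *)
Lemma mgf_unique A :
  <<s \bigcup_(f in S) preimage_set_system [set: T] f measurable >> A ->
  mu A = nu A.
Proof.
move=> sA; have genT : gen setT.
  split => // f gf; under eq_fun do rewrite in_setT mul1r.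
  by [].
apply: (@g_sigma_algebra_measure_unique _ _ _ gen _ (fun=> setT)) => //.
- by move=> B [].
- by rewrite bigcup_const.
- move=> B C [mB gB] [mC gC]; split; first exact: measurableI.
  under eq_fun do rewrite in_setI -mulnb natrM.
  exact: multM.
- by move=> _; rewrite ltey_eq fin_num_measure.
- apply: smallest_sub sA; first exact: smallest_sigma_algebra.
  move=> _ [f Sf [U mU <-]].
  have : <<s (@RGenOInfty.G R) >> U by rewrite -[<<s _ >>]RGenOInfty.measurableE.
  suff : <<s (@RGenOInfty.G R) >> `<=` image_set_system setT f <<s gen >> by apply.
  apply: smallest_sub; first exact/sigma_algebra_image/smallest_sigma_algebra.
  move=> _ [x ->]; apply: sub_sigma_algebra; split.
    by apply: mS.
  rewrite (_ : (fun w => _) = (fun w => (x < f w)%R%:R)); first exact: mult_gt.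
  apply/funext => w; congr ((nat_of_bool _)%:R).
  by apply/idP/idP; rewrite inE/= in_itv/= andbT; tauto.
Qed.
End mgf_uniqueness.

(** * Densities and normal laws *)

Section density.
Context d (T : measurableType d) (R : realType).
Import HBNNSimple.
Local Open Scope ereal_scope.

(** Both sides agree on the simple functions increasing to [f]; monotone convergence is then applied
    under [nu] and under [mu]. *)
Lemma ge0_integral_density (mu nu : {measure set T -> \bar R}) (h : T -> R) (f : T -> \bar R) :
  measurable_fun setT h -> (forall x, 0 <= h x)%R ->
  (forall A, measurable A -> nu A = \int[mu]_(x in A) (h x)%:E) ->
  measurable_fun setT f -> (forall x, 0 <= f x) ->
  \int[nu]_x f x = \int[mu]_x (f x * (h x)%:E).
Proof.
move=> mh h0 nuE mf f0.
pose g := nnsfun_approx measurableT mf.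
have gf x : (g n x)%:E @[n --> \oo] --> f x by exact: cvg_nnsfun_approx.
have ndg m n x : (m <= n)%N -> (g m x <= g n x)%R.
  by move=> mn; exact/lefP/nd_nnsfun_approx.
have mg n : measurable_fun setT (EFin \o g n) by exact/measurable_EFinP.
have g0 n x : 0 <= (g n x)%:E by rewrite lee_fin.
have := @cvg_monotone_convergence _ _ _ nu _ measurableT (fun n => EFin \o g n)
  mg (fun n x _ => g0 n x) (fun x _ m n mn => ndg m n x mn).
have mgh n : measurable_fun setT (fun x => (g n x)%:E * (h x)%:E).
  by apply: emeasurable_funM => //; exact/measurable_EFinP.
have gh0 n x : 0 <= (g n x)%:E * (h x)%:E by rewrite mule_ge0// lee_fin.
have := @cvg_monotone_convergence _ _ _ mu _ measurableT
  (fun n x => (g n x)%:E * (h x)%:E) mgh (fun n x _ => gh0 n x).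
have ndgh x : setT x -> nondecreasing_seq (fun n => (g n x)%:E * (h x)%:E).
  by move=> _ m n mn; rewrite lee_wpmul2r ?lee_fin// ndg.
move=> /(_ ndgh).
rewrite (_ : (fun n => \int[mu]_x ((g n x)%:E * (h x)%:E)) =
    (fun n => \int[nu]_x (EFin \o g n) x)); last first.
  apply/funext => n; rewrite integralT_nnsfun sintegralE.
  under eq_integral => x _.
    rewrite fimfunE -fsumEFin// ge0_mule_fsuml; last first.
      by move=> y; exact: nnfun_muleindic_ge0.
    over.
  rewrite ge0_integral_fsum//; last 2 first.
  - move=> y; apply: emeasurable_funM; apply/measurable_EFinP => //.
    exact: measurable_funM.
  - by move=> y x _; rewrite mule_ge0 ?lee_fin// -lee_fin EFinM nnfun_muleindic_ge0.
  apply: eq_fsbigr => y /set_mem[x _ xy].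
  rewrite nuE//.
  under eq_integral do rewrite EFinM -muleA.
  rewrite ge0_integralZl_EFin//; last 3 first.
  - by move=> z _; rewrite mule_ge0// lee_fin.
  - by apply: emeasurable_funM; apply/measurable_EFinP.
  - by rewrite -xy.
  congr (_ * _); rewrite [RHS]integral_mkcond epatch_indic.
  by apply: eq_integral => z _; rewrite muleC.
have -> : (fun x => limn (fun n => (g n x)%:E * (h x)%:E)) = (fun x => f x * (h x)%:E).
  apply/funext => x; apply/cvg_lim => //.
  exact/cvgeZr.
have -> : (fun x => limn (fun n => (g n x)%:E)) = f.
  by apply/funext => x; exact/cvg_lim.
by move=> h1 h2; apply: cvg_unique h2 h1.
Qed.

End density.

Section density_measure.
Context d (T : measurableType d) (R : realType) (mu : {measure set T -> \bar R}).
Variable h : T -> R.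
Hypothesis mh : measurable_fun [set: T] h.
Hypothesis h0 : forall x, 0 <= h x.
Hypothesis intf : (\int[mu]_x (h x)%:E < +oo)%E.
Local Open Scope ereal_scope.

(** The three proofs are arguments so that the structure of finite measure can be attached to the
    term itself. *)
Definition density_measure of measurable_fun [set: T] h & (forall x, 0 <= h x)%R &
    \int[mu]_x (h x)%:E < +oo : set T -> \bar R :=
  fun A => \int[mu]_(x in A) (h x)%:E.

Local Notation nu := (density_measure mh h0 intf).

Let nu0 : nu set0 = 0. Proof. exact: integral_set0. Qed.

Let nu_ge0 A : 0 <= nu A.
Proof. by apply: integral_ge0 => x _; rewrite lee_fin. Qed.

Let nu_sigma_additive : semi_sigma_additive nu.
Proof.
apply: semi_sigma_additive_nng_induced; first exact/measurable_EFinP.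
by move=> x; rewrite lee_fin.
Qed.

HB.instance Definition _ := isMeasure.Build _ _ _ nu nu0 nu_ge0 nu_sigma_additive.

Let nu_fin : fin_num_fun nu.
Proof.
move=> A mA; rewrite ge0_fin_numE//; apply: le_lt_trans intf.
apply: ge0_subset_integral => //; first exact/measurable_EFinP.
by move=> x _; rewrite lee_fin.
Qed.

HB.instance Definition _ := @Measure_isFinite.Build _ _ _ nu nu_fin.

Lemma integral_density_measure (f : T -> \bar R) :
  measurable_fun setT f -> (forall x, 0 <= f x) ->
  \int[nu]_x f x = \int[mu]_x (f x * (h x)%:E).
Proof. by move=> mf f0; apply: ge0_integral_density. Qed.

End density_measure.

Section normal_integrals.
Variable R : realType.
Implicit Types a b m s : R.

Lemma integral_normal_prob m s (f : R -> R) : measurable_fun setT f ->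
  (forall x, 0 <= f x) ->
  (\int[normal_prob m s]_x (f x)%:E =
   \int[lebesgue_measure]_x ((f x)%:E * (normal_pdf m s x)%:E))%E.
Proof.
move=> mf f0; apply: ge0_integral_density => //.
- exact: measurable_normal_pdf.
- by move=> x; exact: normal_pdf_ge0.
- exact/measurable_EFinP.
Qed.

Lemma integral_cst_normal_pdf (k : R) m s :
  (\int[lebesgue_measure]_x (k%:E * (normal_pdf m s x)%:E) = k%:E)%E.
Proof.
rewrite integralZl//; last exact: integrable_normal_pdf.
by rewrite integral_normal_pdf mule1.
Qed.

(** Completing the square: [expR (a * x)] times the density of mean [m] is a constant times the
    density of mean [m + a * s ^+ 2] and the same deviation. *)
Lemma normal_mgf m s a : s != 0 ->
  (\int[normal_prob m s]_x (expR (a * x))%:E =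
   (expR (a * m + a ^+ 2 * s ^+ 2 / 2))%:E)%E.
Proof.
move=> s0.
rewrite integral_normal_prob; last 2 first.
- by apply: measurableT_comp => //; exact: measurable_funM.
- by move=> x; exact: expR_ge0.
rewrite -[RHS](@integral_cst_normal_pdf _ (m + a * s ^+ 2) s).
apply: eq_integral => x _; rewrite !normal_pdfE//.
rewrite -!EFinM mulrCA [in RHS]mulrCA; congr (_ * _)%:E.
by rewrite /normal_fun -!expRD; congr expR; field.
Qed.

(** The integrand is, up to a constant, the centered normal density of variance [s ^+ 2 / r] with
    [r = 1 + b * s ^+ 2]. Negative [b] are allowed as long as [r > 0]. *)
Lemma normal_gauss s b : s != 0 -> 0 < 1 + b * s ^+ 2 ->
  (\int[normal_prob 0 s]_x (expR (- (b * x ^+ 2 / 2)))%:E =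
   ((Num.sqrt (1 + b * s ^+ 2))^-1)%:E)%E.
Proof.
move=> s0; set r := 1 + _ => r0.
have sr0 : Num.sqrt r != 0 by rewrite gt_eqF// sqrtr_gt0.
rewrite integral_normal_prob; last 2 first.
- apply: measurableT_comp => //; apply: measurableT_comp => //.
  by apply: measurable_funM => //; apply: measurable_funM => //; exact: measurable_funX.
- by move=> x; exact: expR_ge0.
pose s' := s / Num.sqrt r.
have s'0 : s' != 0 by rewrite mulf_neq0// invr_neq0.
have s'2 : s' ^+ 2 = s ^+ 2 / r by rewrite exprMn exprVn sqr_sqrtr// ltW.
rewrite -[RHS](@integral_cst_normal_pdf _ 0 s').
apply: eq_integral => x _; rewrite !normal_pdfE// -!EFinM; congr (_%:E).
have -> : normal_peak s = normal_peak s' / Num.sqrt r.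
  rewrite /normal_peak s'2 -invfM -sqrtrM; last first.
    by rewrite mulrn_wge0// mulr_ge0 ?pi_ge0// divr_ge0// ?sqr_ge0// ltW.
  congr (Num.sqrt _)^-1; field.
  by rewrite gt_eqF.
have -> : normal_fun 0 s' x = expR (- (b * x ^+ 2 / 2)) * normal_fun 0 s x.
  rewrite /normal_fun -expRD s'2; congr expR.
  rewrite /r; field; rewrite s0/= gt_eqF//.
by ring.
Qed.

End normal_integrals.

(** * Identification of the parameters of a centered Gaussian variable *)

Section gaussian_mgf.
Context d (T : measurableType d) (R : realType) (P : probability T R).
Implicit Types (X : T -> R) (a b m s v : R).

Lemma integral_cst_probability (k : \bar R) : (\int[P]__ k = k)%E.
Proof.
transitivity (k * P setT)%E; first exact: integral_cst.
by rewrite probability_setT mule1.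
Qed.

Lemma square_integrable_integrable X : measurable_fun [set: T] X ->
  (\int[P]_w (X w ^+ 2)%:E < +oo)%E -> P.-integrable setT (EFin \o X).
Proof.
move=> mX X2.
apply: (@le_integrable _ _ _ _ _ _ _ (fun w => (1 + X w ^+ 2)%:E)) => //.
- exact/measurable_EFinP.
- move=> w _; rewrite !abse_EFin lee_fin [leRHS]ger0_norm ?addr_ge0 ?sqr_ge0//.
  rewrite -(real_normK (num_real (X w))).
  by have := normr_ge0 (X w); nra.
under eq_fun do rewrite EFinD; apply: integrableD => //.
  exact: finite_measure_integrable_cst.
apply/integrableP; split; first exact/measurable_EFinP/measurable_funX.
by under eq_integral do rewrite abse_EFin ger0_norm ?sqr_ge0//.
Qed.

(** Dirac masses and normal laws satisfy the same two formulas, so the case distinction of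
    [gaussian_law] ends here. The first formula serves to identify [m], the second [s]. *)
Lemma gaussian_law_integrals X : measurable_fun [set: T] X -> gaussian_law P X ->
  exists m s, [/\ 0 <= s,
    forall a, (\int[P]_w (expR (a * X w))%:E =
       (expR (a * m + a ^+ 2 * s ^+ 2 / 2))%:E)%E &
    m = 0 -> forall b, 0 < 1 + b * s ^+ 2 ->
     (\int[P]_w (expR (- (b * X w ^+ 2 / 2)))%:E =
       ((Num.sqrt (1 + b * s ^+ 2))^-1)%:E)%E].
Proof.
move=> mX [m [s [s0 lawX]]]; exists m, s.
have mX' : @measurable_fun _ _ T (measurableTypeR R) setT X by exact: mX.
pose X' : {mfun T >-> measurableTypeR R} :=
  HB.pack (X : T -> measurableTypeR R) (isMeasurableFun.Build _ _ _ _ _ mX').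
have push (f : R -> R) : measurable_fun setT f -> (forall x, 0 <= f x) ->
    forall m : {measure set (measurableTypeR R) -> \bar R},
    (forall U, measurable U -> pushforward P X U = m U) ->
    (\int[P]_w (f (X w))%:E = \int[m]_x (f x)%:E)%E.
  move=> mf f0 mu' muE.
  transitivity (\int[pushforward P X']_x (f x)%:E)%E.
    rewrite ge0_integral_pushforward//.
      exact/measurable_EFinP.
    by move=> x _; rewrite lee_fin.
  by apply: eq_measure_integral => U mU _; exact: muE.
have m1 a : measurable_fun setT (fun x : R => expR (a * x)).
  by apply: measurableT_comp => //; exact: measurable_funM.
have m2 b : measurable_fun setT (fun x : R => expR (- (b * x ^+ 2 / 2))).
  apply: measurableT_comp => //; apply: measurableT_comp => //.
  by apply: measurable_funM => //; apply: measurable_funM => //; exact: measurable_funX.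
have [s_eq0|s_neq0] := eqVneq s 0; move: lawX; rewrite ?s_eq0 ?eqxx ?(negbTE s_neq0) => lawX.
- split=> // [a|m0 b _].
    rewrite (push _ (m1 a) (fun=> expR_ge0 _) (@dirac _ (measurableTypeR R) m R) lawX).
    rewrite integral_dirac//; last by apply/measurable_EFinP; exact: m1.
    by rewrite diracT mul1e expr0n/= mulr0 mul0r addr0.
  rewrite (push _ (m2 b) (fun=> expR_ge0 _) (@dirac _ (measurableTypeR R) m R) lawX).
  rewrite integral_dirac//; last by apply/measurable_EFinP; exact: m2.
  by rewrite diracT mul1e m0 expr0n/= !mulr0 mul0r oppr0 expR0 addr0 sqrtr1 invr1.
- split=> // [a|m0 b b0].
    by rewrite (push _ (m1 a) (fun=> expR_ge0 _) _ lawX) normal_mgf.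
  rewrite m0 in lawX.
  by rewrite (push _ (m2 b) (fun=> expR_ge0 _) _ lawX) normal_gauss.
Qed.

(** With [t = s ^+ 2], squaring the inequality gives [b * (t - v) <= b ^+ 2 * (v * t)] for small [b]
    of either sign, which is only possible if [t = v]. *)
Lemma variance_squeeze s v : 0 <= v ->
  (forall b, 0 < 1 + b * s ^+ 2 -> 1 - b * v / 2 <= (Num.sqrt (1 + b * s ^+ 2))^-1) ->
  s ^+ 2 = v.
Proof.
move=> v0 H; have s20 := sqr_ge0 s; set t := s ^+ 2 in s20 H *.
have H' b : 0 < 1 + b * t -> 0 <= 1 - b * v / 2 -> b * (t - v) <= b ^+ 2 * (v * t).
  move=> b1 b2; have := H b b1; set r := Num.sqrt _ => hr.
  have r2 : r ^+ 2 = 1 + b * t by rewrite sqr_sqrtr// ltW.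
  have r0 : 0 < r by rewrite sqrtr_gt0.
  have : ((1 - b * v / 2) * r) ^+ 2 <= 1.
    rewrite expr_le1//; last by rewrite mulr_ge0// ltW.
    apply: (@le_trans _ _ (r^-1 * r)); first by rewrite ler_wpM2r// ltW.
    by rewrite mulVf// gt_eqF.
  rewrite exprMn r2 => h.
  have h3 : 0 <= (b * v / 2) ^+ 2 * (1 + b * t) by rewrite mulr_ge0 ?sqr_ge0// ltW.
  suff : (1 - b * v) * (1 + b * t) <= 1 by lra.
  apply: le_trans h; rewrite -subr_ge0.
  by have -> : (1 - b * v / 2) ^+ 2 * (1 + b * t) - (1 - b * v) * (1 + b * t) =
     (b * v / 2) ^+ 2 * (1 + b * t) by field.
set n := `|t - v|; have n0 : 0 <= n by exact: normr_ge0.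
pose D := (1 + v) * (1 + t) * (1 + n).
have vt0 : 0 <= v * t by exact: mulr_ge0.
have vn0 : 0 <= v * n by exact: mulr_ge0.
have tn0 : 0 <= t * n by exact: mulr_ge0.
have vtn0 : 0 <= v * t * n by exact: mulr_ge0.
have D0 : 0 < D by rewrite /D; lra.
pose e := n / D.
have ev : e * v <= 1 by rewrite /e mulrAC ler_pdivrMr// /D; lra.
have et : e * t < 1 by rewrite /e mulrAC ltr_pdivrMr// /D; lra.
apply/eqP; rewrite -subr_eq0; apply/negPn/negP => tv.
have np : 0 < n by rewrite normr_gt0.
have ep : 0 < e by rewrite divr_gt0.
have key : e * (v * t) < n.
  by rewrite /e mulrAC ltr_pdivrMr// ltr_pM2l// /D; lra.
have [tv0|tv0] := leP 0 (t - v).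
  have := H' e; rewrite /n ger0_norm// in key.
  have -> : e ^+ 2 * (v * t) = e * (e * (v * t)) by ring.
  rewrite ler_pM2l//; nra.
have := H' (- e); rewrite /n ltr0_norm// in key.
have -> : (- e) ^+ 2 * (v * t) = e * (e * (v * t)) by ring.
have -> : - e * (t - v) = e * (- (t - v)) by ring.
rewrite ler_pM2l//; nra.
Qed.

(** The parameters of the law are found by integrating [1 + x <= expR x]. With [x = a * X] this
    gives [0 <= a * m + a ^+ 2 * s ^+ 2 / 2] for all [a], so [m = 0]; with [x = - b * X ^+ 2 / 2] it
    gives the hypothesis of [variance_squeeze]. *)
Lemma centered_gaussian_mgf X v : measurable_fun [set: T] X -> gaussian_law P X ->
  (\int[P]_w (X w)%:E = 0)%E -> (\int[P]_w (X w ^+ 2)%:E = v%:E)%E ->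
  (\int[P]_w (expR (X w))%:E = (expR (v / 2))%:E)%E.
Proof.
move=> mX gX EX VX; have [m [s [s0 mgfX gaussX]]] := gaussian_law_integrals mX gX.
have v0 : 0 <= v.
  by rewrite -lee_fin -VX; apply: integral_ge0 => w _; rewrite lee_fin sqr_ge0.
have iX : P.-integrable setT (EFin \o X).
  by apply: square_integrable_integrable => //; rewrite VX ltry.
have iX2 : P.-integrable setT (fun w => (X w ^+ 2)%:E).
  apply/integrableP; split; first exact/measurable_EFinP/measurable_funX.
  by under eq_integral do rewrite abse_EFin ger0_norm ?sqr_ge0//; rewrite VX ltry.
have i1 : P.-integrable setT (fun=> 1%:E) by exact: finite_measure_integrable_cst.
have m_eq0 : m = 0.
  have H a : 0 <= a * m + a ^+ 2 * s ^+ 2 / 2.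
    rewrite -ler_expR expR0 -lee_fin -mgfX.
    have -> : 1%:E = (\int[P]_w (1 + a * X w)%:E)%E :> \bar R.
      under eq_integral do rewrite EFinD EFinM.
      rewrite integralD//; last exact: integrableZl.
      by rewrite integralZl// EX mule0 adde0 integral_cst_probability.
    apply: le_integral => //.
    - by under eq_fun do rewrite EFinD EFinM; apply: integrableD => //; exact: integrableZl.
    - apply/integrableP; split.
        by apply/measurable_EFinP/measurableT_comp => //; exact: measurable_funM.
      under eq_integral do rewrite abse_EFin ger0_norm ?expR_ge0//.
      by rewrite mgfX ltry.
    - by move=> w _; rewrite lee_fin expR_ge1Dx.
  apply/eqP/negPn/negP => m0.
  have m2 : 0 < m ^+ 2 by rewrite exprn_even_gt0.
  have q : 0 < 1 + s ^+ 2 by rewrite ltr_pwDl// sqr_ge0.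
  (* A small multiple of [- m], for which the linear term outweighs the quadratic one. *)
  have := H (- m / (1 + s ^+ 2)).
  have -> : - m / (1 + s ^+ 2) * m + (- m / (1 + s ^+ 2)) ^+ 2 * s ^+ 2 / 2 =
     - (m ^+ 2 * (2 + s ^+ 2)) / (2 * (1 + s ^+ 2) ^+ 2).
    by field; rewrite gt_eqF.
  rewrite mulNr oppr_ge0 leNgt divr_gt0// mulr_gt0//.
    by rewrite ltr_pwDl// sqr_ge0.
  by rewrite exprn_gt0.
have sv : s ^+ 2 = v.
  apply: variance_squeeze => // b b0.
  rewrite -lee_fin -gaussX//.
  have -> : (1 - b * v / 2)%:E = (\int[P]_w (1 + (- (b / 2)) * X w ^+ 2)%:E)%E :> \bar R.
    under eq_integral do rewrite EFinD EFinM.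
    rewrite integralD//; last exact: integrableZl.
    rewrite integralZl// VX integral_cst_probability.
    by rewrite -EFinM -EFinD; congr _%:E; field.
  apply: le_integral => //.
  - by under eq_fun do rewrite EFinD EFinM; apply: integrableD => //; exact: integrableZl.
  - apply/integrableP; split.
      apply/measurable_EFinP/measurableT_comp => //; apply: measurableT_comp => //.
      by apply: measurable_funM => //; apply: measurable_funM => //; exact: measurable_funX.
    under eq_integral do rewrite abse_EFin ger0_norm ?expR_ge0//.
    by rewrite gaussX// ltry.
  - move=> w _; rewrite lee_fin; apply: le_trans (expR_ge1Dx _).
    by rewrite le_eqVlt; apply/orP; left; apply/eqP; field.
have := mgfX 1; under eq_integral do rewrite mul1r.
by move=> ->; rewrite m_eq0 mulr0 add0r expr1n mul1r sv.
Qed.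

End gaussian_mgf.

(** * Exponential moments of the sheet *)

Lemma integral_sum_seq d (T : measurableType d) (R : realType)
    (mu : {measure set T -> \bar R}) (I : eqType) (s : seq I) (f : I -> T -> \bar R) :
  (forall i, i \in s -> mu.-integrable setT (f i)) ->
  (\int[mu]_w (\sum_(i <- s) f i w) = \sum_(i <- s) \int[mu]_w f i w)%E.
Proof.
move=> fi; rewrite [RHS]big_tnth -integral_sum//.
  by apply: eq_integral => w _; rewrite big_tnth.
by move=> i; apply: fi; exact: mem_tnth.
Qed.

Section sheet_mgf.
Context d (T : measurableType d) (R : realType) (P : probability T R).
Variable B : R * R -> {RV P >-> R}.
Hypothesis BS : brownian_sheet B.
Implicit Types (z : R * R) (s : seq (R * (R * R))).

Definition sheet_cov z z' : R := Num.min z.1 z'.1 * Num.min z.2 z'.2.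

(** A linear combination is coded by a list of pairs (coefficient, point). Repeated points are
    allowed, so that concatenation is addition; [sheet_quad] is its variance. *)
Definition sheet_lin s w : R := \sum_(p <- s) p.1 * B p.2 w.

Definition sheet_quad s : R :=
  \sum_(p <- s) \sum_(q <- s) p.1 * q.1 * sheet_cov p.2 q.2.

Definition in_quadrant s := forall p, p \in s -> quadrant p.2.

Lemma integral_sheetM z z' : quadrant z -> quadrant z' ->
  (\int[P]_w (B z w * B z' w)%:E = (sheet_cov z z')%:E)%E.
Proof. by case: BS => _ _ + _ qz qz' => /(_ z z' qz qz'); rewrite unlock. Qed.

Lemma integral_sheet z : quadrant z -> (\int[P]_w (B z w)%:E = 0)%E.
Proof. by case: BS => _ + _ _ qz => /(_ z qz); rewrite unlock. Qed.

Lemma measurable_sheet z : measurable_fun [set: T] (B z).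
Proof. by []. Qed.

Lemma measurable_sheet_lin s : measurable_fun [set: T] (sheet_lin s).
Proof. by apply: measurable_sum => p; exact: measurable_funM. Qed.

Lemma integrable_sheet2 z : quadrant z -> P.-integrable setT (fun w => (B z w ^+ 2)%:E).
Proof.
move=> qz; apply/integrableP; split; first exact/measurable_EFinP/measurable_funX.
under eq_integral do rewrite abse_EFin ger0_norm ?sqr_ge0// expr2.
by rewrite integral_sheetM// ltry.
Qed.

Lemma integrable_sheet z : quadrant z -> P.-integrable setT (EFin \o B z).
Proof.
move=> qz; apply: square_integrable_integrable => //.
under eq_integral do rewrite expr2.
by rewrite integral_sheetM// ltry.
Qed.

Lemma integrable_sheetM z z' : quadrant z -> quadrant z' ->
  P.-integrable setT (fun w => (B z w * B z' w)%:E).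
Proof.
move=> qz qz'.
apply: (@le_integrable _ _ _ _ _ _ _ (fun w => (B z w ^+ 2 + B z' w ^+ 2)%:E)) => //.
- by apply/measurable_EFinP; exact: measurable_funM.
- move=> w _; rewrite !abse_EFin lee_fin [leRHS]ger0_norm ?addr_ge0 ?sqr_ge0//.
  rewrite normrM -(real_normK (num_real (B z w))) -(real_normK (num_real (B z' w))).
  have := sqr_ge0 (`|B z w| - `|B z' w|).
  by have := normr_ge0 (B z w); have := normr_ge0 (B z' w); nra.
by under eq_fun do rewrite EFinD; apply: integrableD => //; exact: integrable_sheet2.
Qed.

Lemma gaussian_sheet_lin s : in_quadrant s -> gaussian_law P (sheet_lin s).
Proof.
move=> qs; case: BS => gB _ _ _.
have := gB _ (fun i => (tnth (in_tuple s) i).2) (fun i => (tnth (in_tuple s) i).1)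
  (fun i => qs _ (mem_tnth i (in_tuple s))).
congr (gaussian_law P _); apply/funext => w.
by rewrite /sheet_lin [RHS]big_tnth.
Qed.

Lemma sheet_lin_mgf s : in_quadrant s ->
  (\int[P]_w (expR (sheet_lin s w))%:E = (expR (sheet_quad s / 2))%:E)%E.
Proof.
move=> qs; apply: centered_gaussian_mgf; [exact: measurable_sheet_lin|exact: gaussian_sheet_lin|..].
- under eq_integral do rewrite /sheet_lin -sumEFin.
  rewrite integral_sum_seq//=; last first.
    move=> p /qs qp; under eq_fun do rewrite EFinM.
    by apply: integrableZl => //; exact: integrable_sheet.
  rewrite big_seq big1// => p /qs qp; under eq_integral do rewrite EFinM.
  by rewrite integralZl//; [rewrite integral_sheet// mule0|exact: integrable_sheet].
- under eq_integral do rewrite expr2 /sheet_lin big_distrlr/= -sumEFin.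
  have int p q : p \in s -> q \in s ->
      P.-integrable setT (fun w => (p.1 * B p.2 w * (q.1 * B q.2 w))%:E).
    move=> /qs qp /qs qq; under eq_fun do rewrite mulrACA EFinM.
    by apply: integrableZl => //; exact: integrable_sheetM.
  have int' p : p \in s ->
      P.-integrable setT (fun w => (\sum_(q <- s) p.1 * B p.2 w * (q.1 * B q.2 w))%:E).
    move=> ps; under eq_fun do rewrite -sumEFin big_tnth.
    by apply: integrable_sum => // q _; apply: int => //; exact: mem_tnth.
  rewrite integral_sum_seq// /sheet_quad -sumEFin big_seq [RHS]big_seq.
  apply: eq_bigr => p ps; under eq_integral do rewrite -sumEFin.
  rewrite integral_sum_seq; last by move=> q qs'; exact: int.
  rewrite -sumEFin big_seq [RHS]big_seq; apply: eq_bigr => q qs'.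
  under eq_integral do rewrite mulrACA EFinM.
  rewrite integralZl//; last by apply: integrable_sheetM; exact: qs.
  by rewrite integral_sheetM//; exact: qs.
Qed.

End sheet_mgf.

(** * The exponential martingale *)

Section sheet_martingale.
Context d (T : measurableType d) (R : realType) (P : probability T R).
Variable B : R * R -> {RV P >-> R}.
Hypothesis BS : brownian_sheet B.
Implicit Types (z : R * R) (s t : seq (R * (R * R))) (D : set (R * R)).

Definition sheet_events D : set (set T) :=
  \bigcup_(z in D) preimage_set_system [set: T] (B z) measurable.

(** The analogue of [sheet_filtration] for an arbitrary set of points, since half-strips are needed
    besides rectangles. *)
Definition augmented_sigma D : set (set T) :=
  <<s P.-negligible `|` sheet_events D >>.

Lemma augmented_sigmaS D D' : D `<=` D' -> augmented_sigma D `<=` augmented_sigma D'.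
Proof.
move=> DD'; apply: sub_sigma_algebra2; apply: setUS; exact: bigcup_subset.
Qed.

Definition symdiff (A A' : set T) := (A `\` A') `|` (A' `\` A).

(** The sets that agree up to a negligible set with a set of the unaugmented sigma-algebra form a
    sigma-algebra containing all generators. This reduces augmented events to those that moment
    generating functions control. *)
Lemma augmented_sigma_raw D A : augmented_sigma D A ->
  exists2 A', <<s sheet_events D >> A' & P.-negligible (symdiff A A').
Proof.
apply: (@smallest_sub _ _ _ [set A | exists2 A',
  <<s sheet_events D >> A' & P.-negligible (symdiff A A')]).
- split.
  + exists set0; first exact: sigma_algebra0.
    by rewrite /symdiff !setD0 setU0; exact: negligible_set0.
  + move=> {}A [A' sA' nA]; exists (setT `\` A').
      by have [_ + _] := smallest_sigma_algebra setT (sheet_events D); apply.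
    apply: negligibleS nA => w [[[_ h1] h2]|[[_ h1] h2]].
      by right; split => //; apply: contrapT => h3; exact: h2.
    by left; split => //; apply: contrapT => h3; exact: h2.
  + move=> F hF; have /choice[F' hF'] : forall n, exists A',
        <<s sheet_events D >> A' /\ P.-negligible (symdiff (F n) A').
      by move=> n; have [A' ? ?] := hF n; exists A'.
    exists (\bigcup_n F' n).
      have [_ _ h] := smallest_sigma_algebra setT (sheet_events D).
      by apply: h => n; have [] := hF' n.
    apply: (negligibleS _ (negligible_bigcup (fun n => (hF' n).2))).
    move=> w [[[n _ Fn] h]|[[n _ Fn] h]]; exists n => //.
      by left; split => // h'; apply: h; exists n.
    by right; split => // h'; apply: h; exists n.
- move=> {}A [nA|sA].
    exists set0; first exact: sigma_algebra0.
    by rewrite /symdiff setD0 set0D setU0.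
  exists A; first exact: sub_sigma_algebra.
  by rewrite /symdiff setDv setU0; exact: negligible_set0.
Qed.

Lemma sheet_events_measurable D : <<s sheet_events D >> `<=` @measurable _ T.
Proof.
apply: smallest_sub; first exact: sigma_algebra_measurable.
by move=> A [z Dz [U mU <-]]; exact: measurable_sheet.
Qed.

Lemma augmented_sigma_measurable D : measure_is_complete P ->
  augmented_sigma D `<=` @measurable _ T.
Proof.
move=> cP; apply: smallest_sub; first exact: sigma_algebra_measurable.
move=> A [/cP//|sA]; apply: (@sheet_events_measurable D).
exact: sub_sigma_algebra.
Qed.

Lemma symdiff_ae_eq A A' : P.-negligible (symdiff A A') ->
  {ae P, forall w, A w <-> A' w}.
Proof.
apply: negligibleS => w /= h; apply: contrapT => h'; apply: h.
split => h; apply: contrapT => h''; apply: h'; [left|right]; split => //.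
Qed.

Definition spanned D : set (T -> R) :=
  [set f | exists2 s, forall p, p \in s -> D p.2 & f = sheet_lin B s].

Lemma sheet_lin_cat s t w : sheet_lin B (s ++ t) w = sheet_lin B s w + sheet_lin B t w.
Proof. by rewrite /sheet_lin big_cat. Qed.

Lemma sheet_lin_scale a s w :
  sheet_lin B [seq (a * p.1, p.2) | p <- s] w = a * sheet_lin B s w.
Proof. by rewrite /sheet_lin big_map mulr_sumr; apply: eq_bigr => p _; rewrite mulrA. Qed.

Lemma sheet_lin1 c z w : sheet_lin B [:: (c, z)] w = c * B z w.
Proof. by rewrite /sheet_lin big_seq1. Qed.

Lemma spanned0 D : spanned D (fun=> 0).
Proof. by exists [::] => //; apply/funext => w; rewrite /sheet_lin big_nil. Qed.

Lemma spannedD D f g : spanned D f -> spanned D g -> spanned D (fun w => f w + g w).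
Proof.
move=> [s Ds ->] [t Dt ->]; exists (s ++ t).
  by move=> p; rewrite mem_cat => /orP[/Ds|/Dt].
by apply/funext => w; rewrite sheet_lin_cat.
Qed.

Lemma spannedZ D a f : spanned D f -> spanned D (fun w => a * f w).
Proof.
move=> [s Ds ->]; exists [seq (a * p.1, p.2) | p <- s].
  by move=> _ /mapP[p /Ds Dp ->].
by apply/funext => w; rewrite sheet_lin_scale.
Qed.

Lemma measurable_spanned D f : spanned D f -> measurable_fun [set: T] f.
Proof. by move=> [s _ ->]; exact: measurable_sheet_lin. Qed.

Lemma spanned_sheet D z : D z -> spanned D (B z).
Proof.
move=> Dz; exists [:: (1, z)]; first by move=> p; rewrite inE => /eqP ->.
by apply/funext => w; rewrite /sheet_lin big_seq1 mul1r.
Qed.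

Definition sheet_bil s t : R :=
  \sum_(p <- s) \sum_(q <- t) p.1 * q.1 * sheet_cov p.2 q.2.

Lemma sheet_covC z z' : sheet_cov z z' = sheet_cov z' z.
Proof. by rewrite /sheet_cov minC (minC z.2). Qed.

Lemma sheet_bilC s t : sheet_bil s t = sheet_bil t s.
Proof.
rewrite /sheet_bil exchange_big/=; apply: eq_bigr => p _; apply: eq_bigr => q _.
by rewrite sheet_covC (mulrC p.1).
Qed.

Lemma sheet_bil_catl s s' t : sheet_bil (s ++ s') t = sheet_bil s t + sheet_bil s' t.
Proof. by rewrite /sheet_bil big_cat. Qed.

Lemma sheet_quad_cat s t :
  sheet_quad (s ++ t) = sheet_quad s + 2 * sheet_bil s t + sheet_quad t.
Proof.
have -> u : sheet_quad u = sheet_bil u u by [].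
rewrite sheet_bil_catl sheet_bilC sheet_bil_catl (sheet_bilC t (s ++ t)) sheet_bil_catl.
by rewrite (sheet_bilC t s) mulr2n mulrDl mul1r !addrA.
Qed.

(** The exponential martingale; [z.1 * z.2] is the variance of [B z]. *)
Definition expmart (c : R) z w := expR (c * B z w - c ^+ 2 / 2 * (z.1 * z.2)).

Lemma measurable_expmart c z : measurable_fun [set: T] (expmart c z).
Proof.
apply: measurableT_comp => //; apply: measurable_funB => //.
exact: measurable_funM.
Qed.

(** The factor [expR (c * B z w)] is absorbed as an extra pair [(c, z)] in the list; the variance
    that this pair adds on its own cancels the compensator, and only the covariances with [s]
    remain. *)
Lemma expmart_mgf c z s : quadrant z -> in_quadrant s ->
  (\int[P]_w (expR (sheet_lin B s w) * expmart c z w)%:E =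
   (expR (sheet_quad s / 2 + c * \sum_(p <- s) p.1 * sheet_cov p.2 z))%:E)%E.
Proof.
move=> qz qs.
have E w : expR (sheet_lin B s w) * expmart c z w =
    expR (- (c ^+ 2 / 2 * (z.1 * z.2))) * expR (sheet_lin B (s ++ [:: (c, z)]) w).
  by rewrite /expmart -!expRD sheet_lin_cat sheet_lin1; congr expR; ring.
under eq_integral do rewrite E EFinM.
rewrite ge0_integralZl_EFin ?expR_ge0//; last first.
  by apply/measurable_EFinP/measurableT_comp => //; exact: measurable_sheet_lin.
rewrite sheet_lin_mgf//; last first.
  by move=> p; rewrite mem_cat inE => /orP[/qs//|/eqP ->].
have -> : sheet_quad (s ++ [:: (c, z)]) = sheet_quad s +
    2 * (c * \sum_(p <- s) p.1 * sheet_cov p.2 z) + c ^+ 2 * (z.1 * z.2).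
  rewrite sheet_quad_cat; congr (_ + _ * _ + _).
    by rewrite mulr_sumr; apply: eq_bigr => p _; rewrite big_seq1/=; ring.
  by rewrite /sheet_quad !big_seq1/= /sheet_cov !minxx expr2.
by rewrite -EFinM -expRD; congr (expR _)%:E; field.
Qed.

Lemma integral_expmart c z : quadrant z -> (\int[P]_w (expmart c z w)%:E = 1)%E.
Proof.
move=> qz; have := @expmart_mgf c z [::] qz (fun=> _).
rewrite /sheet_quad !big_nil mul0r mulr0 addr0 expR0 => <- //.
by apply: eq_integral => w _; rewrite /sheet_lin big_nil expR0 mul1r.
Qed.

Definition below z0 : set (R * R) := [set z | quadrant z /\ z.1 <= z0.1 /\ z.2 <= z0.2].

(** The measures of densities [expmart c z0] and [expmart c z1] have the same moment generating
    function on the combinations of sheet values below [z0], because such points have the same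
    covariance with [z0] and with [z1]. *)
Lemma expmart_martingale c z0 z1 A : quadrant z0 -> z0.1 <= z1.1 -> z0.2 <= z1.2 ->
  <<s sheet_events (below z0) >> A ->
  (\int[P]_(w in A) (expmart c z0 w)%:E = \int[P]_(w in A) (expmart c z1 w)%:E)%E.
Proof.
move=> q0 le1 le2 sA.
have q1 : quadrant z1 by split; [exact: le_trans q0.1 le1|exact: le_trans q0.2 le2].
have fin z : quadrant z -> (\int[P]_w (expmart c z w)%:E < +oo)%E.
  by move=> qz; rewrite integral_expmart// ltry.
have pos z w : 0 <= expmart c z w by exact: expR_ge0.
pose m z (qz : quadrant z) := density_measure (measurable_expmart c z) (pos z) (fin z qz).
rewrite -[LHS]/(m z0 q0 A) -[RHS]/(m z1 q1 A).
have mE z qz s : in_quadrant s -> (\int[m z qz]_w (expR (sheet_lin B s w))%:E =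
   (expR (sheet_quad s / 2 + c * \sum_(p <- s) p.1 * sheet_cov p.2 z))%:E)%E.
  move=> qs; rewrite integral_density_measure//.
  - by under eq_integral do rewrite -EFinM; exact: expmart_mgf.
  - by apply/measurable_EFinP/measurableT_comp => //; exact: measurable_sheet_lin.
apply: (@mgf_unique _ _ _ (m z0 q0) (m z1 q1) (spanned (below z0))).
- exact: spanned0.
- exact: spannedD.
- exact: spannedZ.
- exact: measurable_spanned.
- by move=> _ [s Ds ->]; rewrite mE ?ltry// => p /Ds[].
- move=> _ [s Ds ->]; have qs : in_quadrant s by move=> p /Ds[].
  rewrite !mE//; congr (expR (_ + _ * _))%:E.
  rewrite big_seq [RHS]big_seq; apply: eq_bigr => p /Ds[_ [h1 h2]].
  by rewrite /sheet_cov !min_l// (le_trans h1, le_trans h2).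
apply: smallest_sub sA; first exact: smallest_sigma_algebra.
apply: subset_trans (@sub_sigma_algebra _ _ _).
by move=> E [z Dz hz]; exists (B z) => //; exact: spanned_sheet.
Qed.

Lemma expmart_martingale_augmented c z0 z1 A : measure_is_complete P ->
  quadrant z0 -> z0.1 <= z1.1 -> z0.2 <= z1.2 ->
  augmented_sigma (below z0) A ->
  (\int[P]_(w in A) (expmart c z0 w)%:E = \int[P]_(w in A) (expmart c z1 w)%:E)%E.
Proof.
move=> cP q0 le1 le2 aA; have [A' sA' nA] := augmented_sigma_raw aA.
have mA := augmented_sigma_measurable cP aA.
have mA' := sheet_events_measurable sA'.
have E z : (\int[P]_(w in A) (expmart c z w)%:E = \int[P]_(w in A') (expmart c z w)%:E)%E.
  rewrite integral_mkcond [RHS]integral_mkcond; apply: ae_eq_integral => //.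
  - apply/(measurable_restrictT _ _).1 => //.
    exact/measurable_funTS/measurable_EFinP/measurable_expmart.
  - apply/(measurable_restrictT _ _).1 => //.
    exact/measurable_funTS/measurable_EFinP/measurable_expmart.
  - apply: filterS (symdiff_ae_eq nA) => w AA' _; rewrite /patch.
    by congr (if _ then _ else _); apply/idP/idP; rewrite !inE => /AA'.
by rewrite !E; exact: expmart_martingale.
Qed.

End sheet_martingale.

(** * Conditional independence *)

Section conditional_independence.
Context d (T : measurableType d) (R : realType) (P : probability T R).
Variable B : R * R -> {RV P >-> R}.
Hypothesis BS : brownian_sheet B.
Variable z : R * R.
Hypothesis qz : quadrant z.
Implicit Types (q : R * R) (s t : seq (R * (R * R))).

Definition left_of : set (R * R) := [set q | quadrant q /\ q.1 <= z.1].
Definition lower_of : set (R * R) := [set q | quadrant q /\ q.2 <= z.2].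

(** For [q] in [lower_of], [B (proj q)] is the orthogonal projection of [B q] on the sheet values
    over [left_of], and it only involves a point below [z]. *)
Let proj q : R * R := (Num.min q.1 z.1, Num.min q.2 z.2).
Let projs t := [seq (p.1, proj p.2) | p <- t].

Let quadrant_proj q : quadrant q -> quadrant (proj q).
Proof. by move=> [q1 q2]; case: qz => z1 z2; split; rewrite /= le_min ?q1 ?q2. Qed.

Let sheet_cov_left q q' : left_of q -> lower_of q' -> sheet_cov q (proj q') = sheet_cov q q'.
Proof.
move=> [_ h1] [_ h2]; rewrite /sheet_cov /= (min_l h2); congr (_ * _).
by rewrite minCA (min_l h1) minC.
Qed.

Let sheet_cov_under q q' : sheet_cov q (proj q') = sheet_cov (proj q) (proj q').
Proof.
rewrite /sheet_cov/=; congr (_ * _); rewrite -minA; congr (Num.min _ _).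
  by rewrite minCA minxx.
by rewrite minCA minxx.
Qed.

Let sheet_bil_left s t : (forall p, p \in s -> left_of p.2) ->
  (forall p, p \in t -> lower_of p.2) -> sheet_bil s (projs t) = sheet_bil s t.
Proof.
move=> hs ht; rewrite /sheet_bil big_seq [RHS]big_seq; apply: eq_bigr => p /hs hp.
rewrite big_map big_seq [RHS]big_seq; apply: eq_bigr => q /ht hq /=.
by rewrite sheet_cov_left.
Qed.

Let sheet_bil_projs t : sheet_bil t (projs t) = sheet_bil (projs t) (projs t).
Proof.
rewrite /sheet_bil [RHS]big_map; apply: eq_bigr => p _; rewrite !big_map.
by apply: eq_bigr => q _ /=; rewrite sheet_cov_under.
Qed.

Let opps t : seq (R * (R * R)) := [seq (-1 * p.1, p.2) | p <- t].

(** Orthogonality of the remainders [B q - B (proj q)] to the values over [left_of]: the variance of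
    the whole is the sum of the two variances, as if the remainders came from an independent
    sheet. *)
Let sheet_quad_split s t : (forall p, p \in s -> left_of p.2) ->
  (forall p, p \in t -> lower_of p.2) ->
  sheet_quad (s ++ projs t) + sheet_quad (t ++ opps (projs t)) = sheet_quad (s ++ t).
Proof.
move=> hs ht; rewrite !sheet_quad_cat sheet_bil_left//.
have -> : sheet_bil t (opps (projs t)) = - sheet_bil t (projs t).
  rewrite /sheet_bil -sumrN; apply: eq_bigr => p _; rewrite big_map -sumrN.
  by apply: eq_bigr => q _ /=; ring.
have -> : sheet_quad (opps (projs t)) = sheet_quad (projs t).
  rewrite /sheet_quad big_map; apply: eq_bigr => p _; rewrite big_map.
  by apply: eq_bigr => q _ /=; ring.
by rewrite sheet_bil_projs -[sheet_bil (projs t) _]/(sheet_quad (projs t)); ring.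
Qed.

(** [B q] with its remainder read off an independent copy [w.2] of the sheet. *)
Definition coupled q (w : T * T) : R :=
  B (proj q) w.1 + (B q w.2 - B (proj q) w.2).

Let coupled_lin s t (w : T * T) : R := sheet_lin B s w.1 +
  (sheet_lin B (projs t) w.1 + (sheet_lin B t w.2 - sheet_lin B (projs t) w.2)).

Let family : set (T * T -> R) := [set f | exists st,
  [/\ forall p, p \in st.1 -> left_of p.2, forall p, p \in st.2 -> lower_of p.2 &
      f = coupled_lin st.1 st.2]].

Let coupled_linE s t w : coupled_lin s t w =
  sheet_lin B (s ++ projs t) w.1 + sheet_lin B (t ++ opps (projs t)) w.2.
Proof. by rewrite /coupled_lin !sheet_lin_cat sheet_lin_scale; ring. Qed.

Let coupled_lin_diag s t w : coupled_lin s t (w, w) = sheet_lin B (s ++ t) w.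
Proof. by rewrite /coupled_lin sheet_lin_cat/=; ring. Qed.

Let family0 : family (fun=> 0).
Proof.
exists ([::], [::]); split => //; apply/funext => w.
by rewrite /coupled_lin /sheet_lin !big_nil subrr !addr0.
Qed.

Let familyD f g : family f -> family g -> family (fun w => f w + g w).
Proof.
move=> [[s t] /= [hs ht ->]] [[s' t'] /= [hs' ht' ->]].
exists (s ++ s', t ++ t'); split => /=.
- by move=> p; rewrite mem_cat => /orP[/hs|/hs'].
- by move=> p; rewrite mem_cat => /orP[/ht|/ht'].
- by apply/funext => w; rewrite /coupled_lin /projs map_cat !sheet_lin_cat; ring.
Qed.

Let familyZ a f : family f -> family (fun w => a * f w).
Proof.
move=> [[s t] /= [hs ht ->]].
exists ([seq (a * p.1, p.2) | p <- s], [seq (a * p.1, p.2) | p <- t]); split => /=.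
- by move=> _ /mapP[p /hs hp ->].
- by move=> _ /mapP[p /ht hp ->].
- apply/funext => w; rewrite /coupled_lin.
  have -> : projs [seq (a * p.1, p.2) | p <- t] = [seq (a * p.1, p.2) | p <- projs t].
    by rewrite /projs -!map_comp.
  by rewrite !sheet_lin_scale; ring.
Qed.

Let measurable_family f : family f -> measurable_fun [set: T * T] f.
Proof.
move=> [[s t] /= [_ _ ->]]; rewrite /coupled_lin.
apply: measurable_funD; first by apply: measurableT_comp => //; exact: measurable_sheet_lin.
apply: measurable_funD; first by apply: measurableT_comp => //; exact: measurable_sheet_lin.
by apply: measurable_funB; apply: measurableT_comp => //; exact: measurable_sheet_lin.
Qed.

Let diag (w : T) : T * T := (w, w).

Let measurable_diag : measurable_fun setT diag.
Proof. exact: measurable_fun_pair. Qed.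

Let diag_mfun : {RV P >-> (T * T)%type} :=
  HB.pack diag (isMeasurableFun.Build _ _ _ _ _ measurable_diag).

Let in_quadrant_split s t : (forall p, p \in s -> left_of p.2) ->
  (forall p, p \in t -> lower_of p.2) ->
  [/\ in_quadrant (s ++ t), in_quadrant (s ++ projs t) & in_quadrant (t ++ opps (projs t))].
Proof.
move=> hs ht; split => p; rewrite mem_cat => /orP[].
- by move=> /hs[].
- by move=> /ht[].
- by move=> /hs[].
- by move=> /mapP[q /ht[hq _] ->]; exact: quadrant_proj.
- by move=> /ht[].
- by move=> /mapP[_ /mapP[q /ht[hq _] ->] ->]; exact: quadrant_proj.
Qed.

Local Notation PP :=
  (product_subprobability (P : subprobability T R, P : subprobability T R)).

Let diag_mgf f : family f ->
  (\int[distribution P diag_mfun]_w (expR (f w))%:E =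
   \int[PP]_w (expR (f w))%:E)%E /\
  (\int[distribution P diag_mfun]_w (expR (f w))%:E < +oo)%E.
Proof.
move=> fam; have mf := measurable_family fam.
have mef : measurable_fun setT (fun w => (expR (f w))%:E).
  by apply/measurable_EFinP; exact: measurableT_comp.
case: fam => -[s t] /= [hs ht fE]; subst f.
have [q1 q2 q3] := in_quadrant_split hs ht.
have -> : (\int[distribution P diag_mfun]_w (expR (coupled_lin s t w))%:E =
    (expR (sheet_quad (s ++ t) / 2))%:E)%E.
  rewrite ge0_integral_distribution//.
  rewrite -(sheet_lin_mgf BS)//; apply: eq_integral => w _.
  by rewrite /= coupled_lin_diag.
split; last by rewrite ltry.
rewrite /product_subprobability/= fubini_tonelli1//.
rewrite /fubini_F.
under eq_integral => w _.
  under eq_integral do rewrite coupled_linE/= expRD EFinM.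
  rewrite ge0_integralZl_EFin ?expR_ge0//; last first.
    by apply/measurable_EFinP/measurableT_comp => //; exact: measurable_sheet_lin.
  rewrite (sheet_lin_mgf BS)// muleC.
  over.
rewrite ge0_integralZl_EFin ?expR_ge0//; last first.
  by apply/measurable_EFinP/measurableT_comp => //; exact: measurable_sheet_lin.
rewrite (sheet_lin_mgf BS)// -EFinM -expRD; congr (expR _)%:E.
by rewrite -sheet_quad_split//; ring.
Qed.

Definition coupled_events : set (set (T * T)) :=
  \bigcup_(q in lower_of) preimage_set_system [set: T * T] (coupled q) measurable.

(** Resampling the remainders independently does not change their joint law with the sheet over
    [left_of]: by [sheet_quad_split], the diagonal law and the product law have equal moment
    generating functions on [family]. *)
Lemma diag_coupling A E : <<s sheet_events B left_of >> A -> <<s coupled_events >> E ->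
  P (A `&` diag @^-1` E) = (P \x P)%E ((A `*` setT) `&` E).
Proof.
move=> sA sE.
have fam_sigma X : <<s \bigcup_(f in family) preimage_set_system [set: T * T] f measurable >> X ->
    P (diag @^-1` X) = (P \x P)%E X.
  apply: (@mgf_unique _ _ _ (distribution P diag_mfun) (PP) family) => //.
  - by move=> f /diag_mgf[].
  - by move=> f /diag_mgf[].
have := fam_sigma ((A `*` setT) `&` E).
rewrite preimage_setI.
have -> : diag @^-1` (A `*` setT) = A by apply/seteqP; split => w //= [].
apply.
set G := \bigcup_(f in family) _.
apply: (@measurableI _ (g_sigma_algebraType G)).
- rewrite setXT; suff : <<s sheet_events B left_of >> `<=` image_set_system setT fst <<s G >>.
    by move=> /(_ _ sA); rewrite /image_set_system/= setTI.
  apply: smallest_sub; first exact/sigma_algebra_image/smallest_sigma_algebra.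
  move=> _ [q Dq [U mU <-]]; apply: sub_sigma_algebra.
  exists (coupled_lin [:: (1, q)] [::]).
    exists ([:: (1, q)], [::]); split => //= p; by rewrite inE => /eqP ->.
  exists U => //; rewrite !setTI; apply/seteqP; split => w/=;
  by rewrite /coupled_lin sheet_lin1 mul1r /sheet_lin !big_nil subrr !addr0.
- move: E sE; apply: smallest_sub; first exact: smallest_sigma_algebra.
  move=> _ [q Dq [U mU <-]]; apply: sub_sigma_algebra.
  exists (coupled_lin [::] [:: (1, q)]).
    exists ([::], [:: (1, q)]); split => //= p; by rewrite inE => /eqP ->.
  exists U => //; rewrite !setTI; apply/seteqP; split => w/=;
  by rewrite /coupled_lin/= !sheet_lin1 !mul1r {1}/sheet_lin !big_nil add0r.
Qed.

(** [T] equipped with the past of [z] only, so that section probabilities measurable on [TG] define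
    events of that past. *)
Local Notation TG := (g_sigma_algebraType (sheet_events B (below z))).

Let measurable_coupled q : lower_of q ->
  measurable_fun setT (coupled q : TG * T -> R).
Proof.
move=> [qq qz2]; rewrite /coupled; apply: measurable_funD.
  apply: (@measurableT_comp _ _ _ _ _ _ (B (proj q) : TG -> R)); last exact: measurable_fst.
  move=> _ U mU; rewrite setTI; apply: sub_sigma_algebra; exists (proj q).
    by split; [exact: quadrant_proj|rewrite /= !ge_min !lexx !orbT].
  by exists U => //; rewrite setTI.
apply: (@measurableT_comp _ _ _ _ _ _ (fun w => B q w - B (proj q) w)); last exact: measurable_snd.
exact: measurable_funB.
Qed.

(** On the diagonal [coupled q] is [B q]. Off it, [coupled q] depends on [w.1] through the point
    [proj q] below [z], whence the measurability over [TG * T]. *)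
Let lower_lift E : <<s sheet_events B lower_of >> E -> exists X : set (T * T),
  [/\ <<s coupled_events >> X, measurable (X : set (TG * T)) & diag @^-1` X = E].
Proof.
move: E; apply: smallest_sub.
- split.
  + by exists set0; split; [exact: sigma_algebra0|exact: measurable0|rewrite preimage_set0].
  + move=> E [X [sX mX XE]]; exists (~` X); split.
    * rewrite -setTD; have [_ h _] := smallest_sigma_algebra setT coupled_events.
      exact: h.
    * exact: measurableC.
    * by rewrite setTD -XE.
  + move=> E hE; have [X hX] := choice hE.
    exists (\bigcup_n X n); split.
    * have [_ _ h] := smallest_sigma_algebra setT coupled_events.
      by apply: h => n; have [] := hX n.
    * by apply: bigcupT_measurable => n; have [] := hX n.
    * by rewrite preimage_bigcup; apply: eq_bigcupr => n _; have [] := hX n.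
- move=> _ [q Dq [U mU <-]]; exists (coupled q @^-1` U); split.
  + by apply: sub_sigma_algebra; exists q => //; exists U => //; rewrite setTI.
  + by rewrite -[X in measurable X]setTI; exact: measurable_coupled.
  + by apply/seteqP; split => w; rewrite /coupled/= addrC subrK// => -[].
Qed.

Let coupled_events_measurable : <<s coupled_events >> `<=` @measurable _ (T * T)%type.
Proof.
apply: smallest_sub; first exact: sigma_algebra_measurable.
move=> _ [q _ [U mU <-]]; rewrite setTI -[X in measurable X]setTI.
suff mc : measurable_fun setT (coupled q) by exact: mc.
apply: measurable_funD; first exact: measurableT_comp.
by apply: measurable_funB; exact: measurableT_comp.
Qed.

(** By the coupling and Fubini, [g w = P (xsection X w)] is a conditional probability of [E] given
    the sheet over [left_of], and it is measurable for the past of [z]. The set [C] where it is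
    nonzero almost contains [E]; as [A] and [E] almost never meet, [g] vanishes almost everywhere on
    [A]. *)
Lemma raw_separation A E : <<s sheet_events B left_of >> A ->
  <<s sheet_events B lower_of >> E -> P (A `&` E) = 0%E ->
  exists C, [/\ <<s sheet_events B (below z) >> C, P (A `&` C) = 0%E & P (E `\` C) = 0%E].
Proof.
move=> sA sE AE0; have [X [sX mX XE]] := lower_lift sE.
have mX' := coupled_events_measurable sX.
pose g w := P (xsection X w).
have mg : measurable_fun setT (g : T -> \bar R) by exact: measurable_fun_xsection.
have key F : <<s sheet_events B left_of >> F -> P (F `&` E) = (\int[P]_(w in F) g w)%E.
  move=> sF; rewrite -XE diag_coupling// /product_measure1 [RHS]integral_mkcond.
  apply: eq_integral => w _; rewrite /= xsectionI patchE.
  case: ifPn => wF; first by rewrite in_xsectionX// setTI.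
  by rewrite notin_xsectionX// set0I measure0.
have mA := sheet_events_measurable sA.
have sC : <<s sheet_events B (below z) >> [set w | g w != 0%E].
  have : measurable_fun setT (g : TG -> \bar R) by exact: measurable_fun_xsection.
  move=> /(_ measurableT (~` [set 0%E]) (measurableC (emeasurable_set1 _))).
  by rewrite setTI; congr (<<s _ >> _); apply/seteqP; split => w /= /eqP.
have mC := sheet_events_measurable sC.
exists [set w | g w != 0%E]; split => //.
- have : {ae P, forall w, A w -> g w = 0%E}.
    have [+ _] := ae_eq_integral_abs P mA (measurable_funTS mg).
    by apply; rewrite -AE0 key//; apply: eq_integral => w _; rewrite gee0_abs.
  move=> gA; apply/negligibleP; first exact: measurableI.
  by apply: negligibleS gA => w [Aw /= /eqP gw] h; exact/gw/h.
(* The past of [z] is contained in that of [left_of], so [key] applies to the complement of [C],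
   where [g] is zero. *)
- have sC' : <<s sheet_events B left_of >> (~` [set w | g w != 0%E]).
    rewrite -setTD; have [_ h _] := smallest_sigma_algebra setT (sheet_events B left_of).
    apply: h; apply: sub_sigma_algebra2 sC; apply: bigcup_subset => q [qq [q1 q2]].
    by split.
  rewrite setDE setIC key//; apply: integral0_eq => w.
  by move=> /negP; rewrite negbK => /eqP.
Qed.

Lemma augmented_separation A E : measure_is_complete P ->
  augmented_sigma B left_of A -> augmented_sigma B lower_of E ->
  P.-negligible (A `&` E) ->
  exists C, [/\ augmented_sigma B (below z) C, P.-negligible (A `&` C) &
    P.-negligible (E `\` C)].
Proof.
move=> cP aA aE nAE.
have [A' sA' nA] := augmented_sigma_raw aA.
have [E' sE' nE] := augmented_sigma_raw aE.
have mA' := sheet_events_measurable sA'; have mE' := sheet_events_measurable sE'.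
have nAE' : P (A' `&` E') = 0%E.
  apply/negligibleP; first exact: measurableI.
  apply: (negligibleS _ (negligibleU nAE (negligibleU nA nE))) => w [A'w E'w].
  have [Aw|Aw] := pselect (A w); last by right; left; right.
  have [Ew|Ew] := pselect (E w); last by right; right; right.
  by left.
have [C [sC AC EC]] := raw_separation sA' sE' nAE'.
have mC := sheet_events_measurable sC.
exists C; split.
- by apply: sub_sigma_algebra2 sC => X; right.
- have nAC : P.-negligible (A' `&` C) by apply/negligibleP => //; exact: measurableI.
  apply: (negligibleS _ (negligibleU nA nAC)) => w [Aw Cw].
  by have [A'w|A'w] := pselect (A' w); [right|left; left].
- have nEC : P.-negligible (E' `\` C) by apply/negligibleP => //; exact: measurableD.
  apply: (negligibleS _ (negligibleU nE nEC)) => w [Ew Cw].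
  by have [E'w|E'w] := pselect (E' w); [right|left; left].
Qed.

End conditional_independence.

(** * Grid paths through a stopping point *)

Section sigma_algebra_closure.
Context (T : Type) (G : set (set T)).
Hypothesis sG : sigma_algebra setT G.

Lemma sigma_algebra_setC X : G X -> G (~` X).
Proof. by move=> GX; rewrite -setTD; case: sG => _ + _; apply. Qed.

Lemma sigma_algebra_bigcup (I : countType) (X : I -> set T) :
  (forall i, G (X i)) -> G (\bigcup_i X i).
Proof.
move=> GX; case: sG => G0 _ GU.
have -> : \bigcup_i X i = \bigcup_n (if unpickle n is Some i then X i else set0).
  apply/seteqP; split => w [i _ Xw].
    by exists (pickle i) => //; rewrite pickleK.
  by case: unpickle Xw => // k Xw; exists k.
by apply: GU => n; case: unpickle.
Qed.

Lemma sigma_algebra_setU X Y : G X -> G Y -> G (X `|` Y).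
Proof.
move=> GX GY; have -> : X `|` Y = \bigcup_(b : bool) (if b then X else Y).
  apply/seteqP; split => w; last by move=> [[] _]; [left|right].
  by move=> [h|h]; [exists true|exists false].
by apply: sigma_algebra_bigcup => -[].
Qed.

Lemma sigma_algebra_setI X Y : G X -> G Y -> G (X `&` Y).
Proof.
move=> GX GY; rewrite -[X `&` Y]setCK setCI.
by apply/sigma_algebra_setC/sigma_algebra_setU; exact: sigma_algebra_setC.
Qed.

Lemma sigma_algebra_cst (Q : Prop) : G [set _ | Q].
Proof.
have [q|nq] := pselect Q.
  have -> : [set _ | Q] = setT :> set T by apply/seteqP; split.
  by rewrite -setC0; apply: sigma_algebra_setC; case: sG.
have -> : [set _ | Q] = set0 :> set T by apply/seteqP; split.
by case: sG.
Qed.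

End sigma_algebra_closure.

(** * Adapted lattice paths leading to a random grid point *)

Section lattice_path.
Context d (T : measurableType d) (R : realType) (P : probability T R).
Variable F : nat -> nat -> set (set T).
Hypothesis F_sigma : forall i j, sigma_algebra setT (F i j).
Hypothesis F_mono : forall i j i' j', (i <= i')%N -> (j <= j')%N -> F i j `<=` F i' j'.
Variable A : nat -> nat -> set T.
Hypothesis FA : forall i j, F i j (A i j).
Hypothesis A_inj : forall i j i' j' w, A i j w -> A i' j' w -> i = i' /\ j = j'.
Variable C : nat -> nat -> set T.
Hypothesis FC : forall i j, F i j (C i j).

Definition above_events i j : set T := \bigcup_(k in [set k | (j < k)%N]) A i k.
Definition right_events i j : set T := \bigcup_(k in [set k | (i < k)%N]) A k j.

Hypothesis C_above : forall i j, P.-negligible (above_events i j `&` C i j).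
Hypothesis C_right : forall i j, P.-negligible (right_events i j `\` C i j).
Variable K : nat.

(** The path stops at the target, goes right on [C] and up otherwise. A step that would leave the
    square of side [K] is replaced by standing still. *)
Definition path_step w (p : nat * nat) : nat * nat :=
  if pselect (A p.1 p.2 w) then p
  else if pselect (C p.1 p.2 w) then (if (p.1 < K)%N then (p.1.+1, p.2) else p)
  else (if (p.2 < K)%N then (p.1, p.2.+1) else p).

Definition path n w := iter n (path_step w) (0%N, 0%N).

Lemma path_box n w : (((path n w).1 <= K) && ((path n w).2 <= K))%N.
Proof.
elim: n => //= n /andP[h1 h2]; rewrite /path_step.
case: pselect => a; [|case: pselect => c; case: ifP => /= h]; rewrite ?h1 ?h2 ?h ?andbT//.
Qed.

(** Each move raises the sum of the coordinates by one. A path still moving after [2 K] steps would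
    therefore be at the corner [(K, K)], where no move is possible. *)
Lemma path_stops w : path_step w (path K.*2 w) = path K.*2 w.
Proof.
have S p : path_step w p = p \/ ((path_step w p).1 + (path_step w p).2 = (p.1 + p.2).+1)%N.
  rewrite /path_step; case: pselect => [a|na]; first by left.
  by case: pselect => [c|nc]; case: ifP => h; [right|left|right|left]; rewrite //= ?addSn ?addnS.
have H n : path_step w (path n w) = path n w \/ ((path n w).1 + (path n w).2 = n)%N.
  elim: n => [|n [ih|ih]]; first by right.
    by left; rewrite /path iterS -/(path n w) !ih.
  rewrite /path iterS -/(path n w); have [e|e] := S (path n w).
    by left; rewrite !e.
  by right; rewrite e ih.
have [//|e] := H K.*2.
have /andP[h1 h2] := path_box K.*2 w.
have [e1 e2] : (path K.*2 w).1 = K /\ (path K.*2 w).2 = K by lia.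
rewrite /path_step e1 e2 ltnn; case: pselect => //; by case: pselect.
Qed.

Let step_event i j q : F i j [set w | path_step w (i, j) = q].
Proof.
have -> : [set w | path_step w (i, j) = q] =
    (A i j `&` [set _ | (i, j) = q]) `|`
    (~` A i j `&` ((C i j `&` [set _ | (if (i < K)%N then (i.+1, j) else (i, j)) = q]) `|`
     (~` C i j `&` [set _ | (if (j < K)%N then (i, j.+1) else (i, j)) = q]))).
  apply/seteqP; split => w; rewrite /path_step/=.
    case: pselect => [a|na]; first by left.
    by case: pselect => [c|nc] e; right; split => //; [left|right].
  by case: pselect => [a|na]; [|case: pselect => [c|nc]]; move=> [[? ?]|[? [[? ?]|[? ?]]]].
apply: sigma_algebra_setU => //.
  by apply: sigma_algebra_setI => //; exact: sigma_algebra_cst.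
apply: sigma_algebra_setI => //; first exact: sigma_algebra_setC.
by apply: sigma_algebra_setU => //; apply: sigma_algebra_setI => //;
  [exact: sigma_algebra_cst|exact: sigma_algebra_setC|exact: sigma_algebra_cst].
Qed.

Let path_step_ge w p : (p.1 <= (path_step w p).1)%N && (p.2 <= (path_step w p).2)%N.
Proof.
rewrite /path_step; case: pselect => [a|na]; first by rewrite !leqnn.
by case: pselect => [c|nc]; case: ifP => _ /=; rewrite ?leqnn ?leqnSn.
Qed.

(** Steps never decrease a coordinate, so the preceding point [p] lies below [(i, j)]; the choice
    made at [p] is decided by the past of [p], which is contained in [F i j]. *)
Lemma path_event n i j : F i j [set w | path n w = (i, j)].
Proof.
elim: n i j => [|n ih] i j; first exact: (sigma_algebra_cst (F_sigma i j) ((0%N, 0%N) = (i, j))).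
have -> : [set w | path n.+1 w = (i, j)] = \bigcup_(p : nat * nat)
   ([set w | path n w = p] `&` [set w | path_step w p = (i, j)]).
  apply/seteqP; split => w; first by move=> h; exists (path n w).
  by move=> [p _ [/= <-]].
apply: sigma_algebra_bigcup => // -[i' j'].
have [/andP[le1 le2]|nle] := boolP ((i' <= i)%N && (j' <= j)%N).
  by apply: sigma_algebra_setI => //; apply: (F_mono le1 le2).
have -> : [set w | path_step w (i', j') = (i, j)] = set0.
  apply/seteqP; split => w //= h; have := path_step_ge w (i', j').
  by rewrite h (negbTE nle).
by rewrite setI0; case: (F_sigma i j).
Qed.

(** Almost surely the path never overshoots the target [(a, b)]: a step right from column [a] would
    mean that the target is straight above a point where [C] holds, and a step up from row [b] that
    it is straight to the right of a point where [C] fails. *)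
Lemma path_below : {ae P, forall w, forall a b, A a b w ->
  [/\ ((path K.*2 w).1 <= a)%N, ((path K.*2 w).2 <= b)%N &
    (a <= K)%N -> (b <= K)%N -> path K.*2 w = (a, b)]}.
Proof.
have ae1 : {ae P, forall w, forall i j, ~ (above_events i j `&` C i j) w}.
  apply: ae_foralln => i; apply: ae_foralln => j.
  by apply: negligibleS (C_above i j) => w /= /contrapT.
have ae2 : {ae P, forall w, forall i j, ~ (right_events i j `\` C i j) w}.
  apply: ae_foralln => i; apply: ae_foralln => j.
  by apply: negligibleS (C_right i j) => w /= /contrapT.
apply: filterS2 ae1 ae2 => w h1 h2 a b Aab.
have goR i j : (i <= a)%N -> (j <= b)%N -> ~ A i j w -> C i j w -> (i < a)%N.
  move=> ia jb nA c; rewrite ltn_neqAle ia andbT; apply/eqP => e.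
  apply: (h1 i j); split => //; exists b; last by rewrite /= e.
  rewrite /= ltn_neqAle jb andbT; apply/eqP => e'.
  by apply: nA; rewrite e e'.
have goU i j : (i <= a)%N -> (j <= b)%N -> ~ A i j w -> ~ C i j w -> (j < b)%N.
  move=> ia jb nA c; rewrite ltn_neqAle jb andbT; apply/eqP => e.
  apply: (h2 i j); split => //; exists a; last by rewrite /= e.
  rewrite /= ltn_neqAle ia andbT; apply/eqP => e'.
  by apply: nA; rewrite e e'.
have le n : ((path n w).1 <= a)%N /\ ((path n w).2 <= b)%N.
  elim: n => // n; rewrite /path iterS -/(path n w) => -[h3 h4].
  rewrite /path_step; case: pselect => [A'|nA]; first by [].
  case: pselect => [c|nc]; case: ifP => // _; split => //=.
    exact: goR nA c.
  exact: goU nA nc.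
have [le1 le2] := le K.*2; split => // aK bK.
(* If the target lies in the square, a path that is below it but elsewhere still has an admissible
   move, so the final point is the target. *)
have := path_stops w; set p := path K.*2 w in le1 le2 *.
rewrite /path_step; case: pselect => [A'|nA].
  by move=> _; have [<- <-] := A_inj A' Aab; rewrite -surjective_pairing.
case: pselect => [c|nc].
  have h := goR _ _ le1 le2 nA c; rewrite (leq_trans h aK).
  by move=> /(congr1 fst)/= /esym/n_Sn.
have h := goU _ _ le1 le2 nA nc; rewrite (leq_trans h bK).
by move=> /(congr1 snd)/= /esym/n_Sn.
Qed.

End lattice_path.

(** * The exponential martingale stopped along a grid path *)

Section stopped_martingale.
Context d (T : measurableType d) (R : realType) (P : probability T R).
Variable B : R * R -> {RV P >-> R}.
Hypothesis cP : measure_is_complete P.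
Hypothesis BS : brownian_sheet B.
Variable tau : {RV P >-> (\bar R * \bar R)%type}.
Hypothesis tau_stop : stopping_point B tau.
Variables (h : R) (h0 : 0 < h) (K : nat).

Definition grid (i j : nat) : R * R := (i%:R * h, j%:R * h).

(* [i] is the rank of [t] among the cells {0}, ]0, h], ]h, 2h], ... *)
Definition in_cell (i : nat) (t : \bar R) : Prop :=
  (t <= (i%:R * h)%:E)%E /\ (i = 0%N \/ ((i.-1%:R * h)%:E < t)%E).

Definition cell i j : set T := [set w | in_cell i (tau w).1 /\ in_cell j (tau w).2].

Let F i j : set (set T) := augmented_sigma B (below (grid i j)).

Lemma quadrant_grid i j : quadrant (grid i j).
Proof. by split; rewrite /= mulr_ge0// ltW. Qed.

Let F_sigma i j : sigma_algebra setT (F i j).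
Proof. exact: smallest_sigma_algebra. Qed.

Let F_mono i j i' j' : (i <= i')%N -> (j <= j')%N -> F i j `<=` F i' j'.
Proof.
move=> ii' jj'; apply: augmented_sigmaS => z [qz [/= z1 z2]]; split => //=; split.
  by rewrite (le_trans z1)// ler_pM2r// ler_nat.
by rewrite (le_trans z2)// ler_pM2r// ler_nat.
Qed.

Let reached i j : set T :=
  [set w | ((tau w).1 <= (i%:R * h)%:E)%E /\ ((tau w).2 <= (j%:R * h)%:E)%E].

Let F_reached i j : F i j (reached i j).
Proof.
have [_ /(_ (i%:R * h) (j%:R * h))] := tau_stop.
have [q1 q2] := quadrant_grid i j; move=> /(_ q1 q2).
rewrite /sheet_filtration /F /augmented_sigma /sheet_events.
suff -> : below (grid i j) = [set z | (0 <= z.1 <= i%:R * h) && (0 <= z.2 <= j%:R * h)] by [].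
apply/seteqP; split => z /=.
  by move=> [[z1 z2] [/= z3 z4]]; rewrite z1 z2 z3 z4.
by move=> /andP[/andP[z1 z2] /andP[z3 z4]].
Qed.

(** A cell is a quadrant event of [tau] minus its neighbours to the left and below; at index 0 there
    is nothing to remove. *)
Let F_cell i j : F i j (cell i j).
Proof.
have -> : cell i j = reached i j `&`
    (~` (if i is i'.+1 then reached i' j else set0) `&`
     ~` (if j is j'.+1 then reached i j' else set0)).
  apply/seteqP; split => w; rewrite /cell /reached /in_cell/=.
    move=> [[h1 h2] [h3 h4]]; split => //; split.
      case: i h1 h2 => [|i] _; first by move=> _ [].
      by case=> // h2 [/= h5 _]; move: h2; rewrite ltNge h5.
    case: j h3 h4 => [|j] _; first by move=> _ [].
    by case=> // h4 [/= _ h5]; move: h4; rewrite ltNge h5.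
  move=> [[h1 h2] [h3 h4]]; split; split => //.
    case: i h1 h3 {h4} => [|i] h1 h3; [by left|right].
    by rewrite ltNge; apply/negP => h5; apply: h3; split.
  case: j h2 h4 {h3} => [|j] h2 h4; [by left|right].
  by rewrite ltNge; apply/negP => h5; apply: h4; split.
have F0 i' j' : F i' j' set0 by case: (F_sigma i' j').
have sF := F_sigma i j.
apply: (sigma_algebra_setI sF) => //.
apply: (sigma_algebra_setI sF); apply: (sigma_algebra_setC sF).
  by case: i {sF} => [//|i]; apply: (@F_mono i j).
by case: j {sF} => [//|j]; apply: (@F_mono i j).
Qed.

Let in_cell_inj i i' t : in_cell i t -> in_cell i' t -> i = i'.
Proof.
wlog ii' : i i' / (i < i')%N => [H hi hi'|].
  by case: (ltngtP i i') => // ii'; [exact: H|apply/esym; exact: H].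
move=> [h1 _] [_ [e|]]; first by rewrite e in ii'.
rewrite ltNge => /negP; case; apply: le_trans h1 _.
by rewrite lee_fin ler_pM2r// ler_nat -ltnS prednK// (leq_trans _ ii').
Qed.

Lemma cell_inj i j i' j' w : cell i j w -> cell i' j' w -> i = i' /\ j = j'.
Proof. by move=> [h1 h2] [h3 h4]; split; [exact: in_cell_inj h1 h3|exact: in_cell_inj h2 h4]. Qed.

(** Cells straight above [(i, j)] are events of [left_of (grid i j)], cells straight to its right
    are events of [lower_of (grid i j)], and they are disjoint. [augmented_separation] thus supplies
    the decision events that steer the path. *)
Lemma stopping_path : exists s : T -> nat * nat,
  [/\ forall w, ((s w).1 <= K)%N && ((s w).2 <= K)%N,
      forall i j, augmented_sigma B (below (grid i j)) [set w | s w = (i, j)] &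
      {ae P, forall w, forall a b, cell a b w ->
        [/\ ((s w).1 <= a)%N, ((s w).2 <= b)%N &
          (a <= K)%N -> (b <= K)%N -> s w = (a, b)]}].
Proof.
have : forall p : nat * nat, exists C, [/\ F p.1 p.2 C,
    P.-negligible (above_events cell p.1 p.2 `&` C) &
    P.-negligible (right_events cell p.1 p.2 `\` C)].
  move=> [i j] /=; apply: augmented_separation => //; first exact: quadrant_grid.
  - apply: (@bigcup_measurable _ (g_sigma_algebraType
      (P.-negligible `|` sheet_events B (left_of (grid i j))))).
    move=> k _; have := @F_cell i k; apply: augmented_sigmaS.
    by move=> z [qz [z1 _]].
  - apply: (@bigcup_measurable _ (g_sigma_algebraType
      (P.-negligible `|` sheet_events B (lower_of (grid i j))))).
    move=> k _; have := @F_cell k j; apply: augmented_sigmaS.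
    by move=> z [qz [_ z1]].
  - rewrite (_ : _ `&` _ = set0); first exact: negligible_set0.
    apply/seteqP; split => // w [[k /= jk c1] [k' /= ik' c2]].
    by have [e _] := cell_inj c1 c2; rewrite e ltnn in ik'.
move=> /choice[C hC]; pose C' i j := C (i, j).
exists (path cell C' K K.*2); split.
- exact: path_box.
- move=> i j; apply: (path_event F_sigma F_mono F_cell _) => i' j'.
  by have [] := hC (i', j').
- apply: path_below.
  + exact: cell_inj.
  + by move=> i j; have [] := hC (i, j).
  + by move=> i j; have [] := hC (i, j).
Qed.

Section stopped.
Variable s : T -> nat * nat.
Implicit Types (f : nat -> nat -> T -> R).
Hypothesis s_box : forall w, ((s w).1 <= K)%N && ((s w).2 <= K)%N.
Hypothesis s_event : forall i j, augmented_sigma B (below (grid i j)) [set w | s w = (i, j)].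

Definition stopped (f : nat -> nat -> T -> R) w := f (s w).1 (s w).2 w.

Let ev (p : 'I_K.+1 * 'I_K.+1) : set T := [set w | s w = (p.1 : nat, p.2 : nat)].

Let measurable_ev p : measurable (ev p).
Proof. by apply: (augmented_sigma_measurable cP); exact: s_event. Qed.

Let stopped_sum f w :
  stopped f w = \sum_(p : 'I_K.+1 * 'I_K.+1) f p.1 p.2 w * \1_(ev p) w.
Proof.
have /andP[h1 h2] := s_box w.
rewrite (bigD1 (Ordinal (h1 : ((s w).1 < K.+1)%N), Ordinal (h2 : ((s w).2 < K.+1)%N)))//=.
rewrite indicE mem_set ?mulr1; last by rewrite /ev/= -surjective_pairing.
rewrite big1 ?addr0// => -[p q] /= ne; rewrite indicE memNset ?mulr0// /ev/= => e.
by move/eqP: ne; apply; congr pair; apply: val_inj; rewrite /= e.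
Qed.

Lemma measurable_stopped f : (forall i j, measurable_fun [set: T] (f i j)) ->
  measurable_fun [set: T] (stopped f).
Proof.
move=> mf; rewrite (_ : stopped f = fun w =>
    \sum_(p : 'I_K.+1 * 'I_K.+1) f p.1 p.2 w * \1_(ev p) w).
  by apply: measurable_sum => p; exact: measurable_funM.
by apply/funext => w; exact: stopped_sum.
Qed.

Lemma integral_stopped f : (forall i j, measurable_fun [set: T] (f i j)) ->
  (forall i j w, 0 <= f i j w) ->
  (\int[P]_w (stopped f w)%:E =
   \sum_(p : 'I_K.+1 * 'I_K.+1) \int[P]_(w in ev p) (f p.1 p.2 w)%:E)%E.
Proof.
move=> mf f0; under eq_integral do rewrite stopped_sum -sumEFin.
rewrite ge0_integral_sum//; last 2 first.
- by move=> p; apply/measurable_EFinP; apply: measurable_funM.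
- by move=> p w _; rewrite lee_fin mulr_ge0.
apply: eq_bigr => p _; rewrite [RHS]integral_mkcond; apply: eq_integral => w _.
by rewrite epatch_indic/= EFinM.
Qed.

(** Optional stopping: on each event [s w = (i, j)], which belongs to the past of that grid point,
    the martingale property replaces the value there by the value at the corner [(K, K)]. *)
Lemma integral_stopped_expmart c :
  (\int[P]_w (stopped (fun i j => expmart B c (grid i j)) w)%:E = 1)%E.
Proof.
rewrite integral_stopped; last 2 first.
- by move=> i j; exact: measurable_expmart.
- by move=> i j w; exact: expR_ge0.
rewrite -(integral_expmart BS c (quadrant_grid K K)).
transitivity (\int[P]_w (stopped (fun _ _ => expmart B c (grid K K)) w)%:E)%E; last by [].
rewrite integral_stopped; last 2 first.
- by move=> i j; exact: measurable_expmart.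
- by move=> i j w; exact: expR_ge0.
apply: eq_bigr => p _; apply: expmart_martingale_augmented => //.
- exact: quadrant_grid.
- by rewrite /= ler_pM2r// ler_nat -ltnS.
- by rewrite /= ler_pM2r// ler_nat -ltnS.
Qed.

(** The square of [expmart c] is [expmart (2 * c)] times a factor bounded on the square. The bound
    depends on [K] and [h] through [K * h] alone, hence stays fixed as the mesh is refined. *)
Lemma integral_stopped_expmart_sqr c :
  (\int[P]_w (stopped (fun i j => expmart B c (grid i j)) w ^+ 2)%:E <=
   (expR (c ^+ 2 * (K%:R * h) ^+ 2))%:E)%E.
Proof.
have sqr z w : expmart B c z w ^+ 2 = expR (c ^+ 2 * (z.1 * z.2)) * expmart B (2 * c) z w.
  by rewrite /expmart -expRM_natl -expRD; congr expR; field.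
apply: (@le_trans _ _ (\int[P]_w ((expR (c ^+ 2 * (K%:R * h) ^+ 2))%:E *
    (stopped (fun i j => expmart B (2 * c) (grid i j)) w)%:E))%E); last first.
  rewrite ge0_integralZl_EFin ?expR_ge0//.
  - by rewrite integral_stopped_expmart mule1.
  - by move=> w _; rewrite lee_fin expR_ge0.
  - by apply/measurable_EFinP/measurable_stopped => i j; exact: measurable_expmart.
apply: ge0_le_integral => //.
- by move=> w _; rewrite lee_fin sqr_ge0.
- apply/measurable_EFinP/measurable_funX; apply: measurable_stopped => i j.
  exact: measurable_expmart.
- apply: measurable_funeM; apply/measurable_EFinP; apply: measurable_stopped => i j.
  exact: measurable_expmart.
- move=> w _; rewrite -EFinM lee_fin /stopped sqr ler_wpM2r ?expR_ge0// ler_expR.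
  rewrite ler_wpM2l ?sqr_ge0// expr2 /=; have /andP[h1 h2] := s_box w.
  by apply: ler_pM; rewrite ?mulr_ge0 ?(ltW h0)// ler_pM2r// ler_nat.
Qed.

End stopped.

End stopped_martingale.

(** * Passage to the limit *)

Section clip.
Variable R : realType.
Implicit Types (u : nat -> R) (l b : R).

Lemma cvg_max_cst u l b : u n @[n --> \oo] --> l ->
  Num.max (u n) b @[n --> \oo] --> Num.max l b.
Proof.
move=> /cvgrPdist_le ul; apply/cvgrPdist_le => e e0.
apply: filterS (ul e e0) => n; rewrite !ler_norml.
by case: (leP l b); case: (leP (u n) b) => h1 h2 /andP[h3 h4]; apply/andP; split; lra.
Qed.

Lemma cvg_min_cst u l b : u n @[n --> \oo] --> l ->
  Num.min (u n) b @[n --> \oo] --> Num.min l b.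
Proof.
move=> /cvgrPdist_le ul; apply/cvgrPdist_le => e e0.
apply: filterS (ul e e0) => n; rewrite !ler_norml.
by case: (leP l b); case: (leP (u n) b) => h1 h2 /andP[h3 h4]; apply/andP; split; lra.
Qed.

End clip.

(** * Behaviour of a single sample path as the mesh tends to zero *)

Section paths.
Variables (R : realType) (f : R * R -> R).
Hypothesis cf : {within @quadrant R, continuous f}.

Lemma within_quadrant_delta x e : quadrant x -> 0 < e ->
  exists2 r, 0 < r & forall u, quadrant u -> `|x.1 - u.1| < r -> `|x.2 - u.2| < r ->
    `|f x - f u| < e.
Proof.
move=> qx e0; have /subspace_continuousP/(_ x qx)/cvgrPdist_lt/(_ e e0) := cf.
rewrite near_withinE => /nbhs_ballP[r r0 H]; exists r => // u qu u1 u2.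
by apply: H.
Qed.

Lemma grid_uniform_continuity (N e : R) : 0 < e ->
  \forall n \near \oo, forall x, quadrant x -> x.1 <= N -> x.2 <= N ->
  forall u, quadrant u -> `|x.1 - u.1| <= n.+1%:R^-1 -> `|x.2 - u.2| <= n.+1%:R^-1 ->
  `|f x - f u| <= e.
Proof.
move=> e0; pose box : set (R * R) := `[0, N] `*` `[0, N].
have cbox : compact box by apply: compact_setX; exact: segment_compact.
have box_q x : box x -> quadrant x.
  by move=> [/=]; rewrite !in_itv/= => /andP[? _] /andP[? _].
pose Q n (x : R * R) := forall u, quadrant u -> `|x.1 - u.1| <= n.+1%:R^-1 ->
  `|x.2 - u.2| <= n.+1%:R^-1 -> `|f x - f u| <= e.
have : \forall n \near \oo, box `<=` Q n.
  apply: (near_covering_withinP box).2; first exact/compact_near_coveringP.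
  move=> x bx; have e20 : 0 < e / 2 by rewrite divr_gt0.
  have [r r0 H] := within_quadrant_delta (box_q _ bx) e20.
  have r20 : 0 < r / 2 by rewrite divr_gt0.
  near=> x' n => bx' u qu u1 u2.
  have hn : n.+1%:R^-1 < r / 2 by near: n; exact: (near_infty_natSinv_lt (PosNum r20)).
  have [x1 x2] : ball x (r / 2) x' by near: x'; exact: nbhsx_ballx.
  have h1 : `|f x - f x'| < e / 2.
    by apply: H; [exact: box_q|rewrite (lt_trans x1)|rewrite (lt_trans x2)] => //;
       rewrite ltr_pdivrMr// ltr_pMr// ltr1n.
  have h2 : `|f x - f u| < e / 2.
    apply: H => //.
      rewrite (le_lt_trans (ler_distD x'.1 _ _))// (splitr r) ltrD//.
      exact: le_lt_trans hn.
    rewrite (le_lt_trans (ler_distD x'.2 _ _))// (splitr r) ltrD//.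
    exact: le_lt_trans hn.
  rewrite (le_trans (ler_distD (f x) _ _))// (splitr e) lerD// ?ltW//.
  by rewrite distrC.
apply: filterS => n H x qx x1 x2; apply: H; split => /=; rewrite in_itv/=.
  by rewrite qx.1.
by rewrite qx.2.
Unshelve. all: by end_near. Qed.

Variables (z : R * R) (c y : R).
Hypothesis qz : quadrant z.
Hypothesis fz : f z = y.
Hypothesis f_le : forall q, quadrant q -> q.1 <= z.1 -> q.2 <= z.2 -> c * f q <= c * y.
Variables (N : nat) (p : nat -> nat * nat).

Let h n : R := n.+1%:R^-1.
Let h0 n : 0 < h n. Proof. by rewrite invr_gt0. Qed.
Let hK n : (N * n.+1)%:R * h n = N%:R.
Proof. by rewrite /h natrM mulfK. Qed.

Hypothesis p_box : forall n, ((p n).1 <= N * n.+1)%N && ((p n).2 <= N * n.+1)%N.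
Hypothesis p_cell : forall n a b, in_cell (h n) a (z.1)%:E -> in_cell (h n) b (z.2)%:E ->
  [/\ ((p n).1 <= a)%N, ((p n).2 <= b)%N &
     (a <= N * n.+1)%N -> (b <= N * n.+1)%N -> p n = (a, b)].

Lemma in_cell_exists n (t : R) : 0 <= t -> exists a, in_cell (h n) a t%:E.
Proof.
move=> t0; have ex : exists a : nat, t <= a%:R * h n.
  exists (Num.truncn (t * n.+1%:R)).+1.
  by rewrite ler_pdivlMr// ltW// truncnS_gt.
exists (ex_minn ex); case: ex_minnP => a ta amin; split; first by rewrite lee_fin.
case: a ta amin => [|a] ta amin; [by left|right].
rewrite lte_fin ltNge/=; apply/negP => /amin.
by rewrite ltnn.
Qed.

Lemma in_cell_dist n a (t : R) : 0 <= t -> in_cell (h n) a t%:E ->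
  t <= a%:R * h n <= t + h n.
Proof.
move=> t0 [+ h1]; rewrite lee_fin => -> /=; case: h1 => [->|].
  by rewrite mul0r addr_ge0// ltW.
rewrite lte_fin; case: a => [|a] /= h1; first by rewrite mul0r addr_ge0// ltW.
by rewrite -natr1 mulrDl mul1r lerD2r ltW.
Qed.

Let X n := expR (c * f (grid (h n) (p n).1 (p n).2) -
  c ^+ 2 / 2 * ((p n).1%:R * h n * ((p n).2%:R * h n))).

(** The limit of the stopped values when [z] lies in the square; otherwise an asymptotic upper bound
    for them. *)
Definition hit_limit : R := if (z.1 <= N%:R) && (z.2 <= N%:R)
  then expR (c * y - c ^+ 2 / 2 * (z.1 * z.2)) else expR (c * y).

Let cvg_h : h n @[n --> \oo] --> 0.
Proof. exact: cvg_harmonic. Qed.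

Lemma hit_limit_le : hit_limit <= expR (c * y).
Proof.
rewrite /hit_limit; case: ifP => // _; rewrite ler_expR lerBlDr lerDl.
by case: qz => z1 z2; rewrite mulr_ge0 ?divr_ge0 ?sqr_ge0// mulr_ge0.
Qed.

Let cvg_inside : z.1 <= N%:R -> z.2 <= N%:R ->
  X n @[n --> \oo] --> expR (c * y - c ^+ 2 / 2 * (z.1 * z.2)).
Proof.
move=> z1 z2.
have pE n : z.1 <= (p n).1%:R * h n <= z.1 + h n /\ z.2 <= (p n).2%:R * h n <= z.2 + h n.
  have [a ha] := in_cell_exists n qz.1; have [b hb] := in_cell_exists n qz.2.
  have [_ _ H] := p_cell ha hb.
  have small t k : 0 <= t -> t <= N%:R -> in_cell (h n) k t%:E -> (k <= N * n.+1)%N.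
    move=> t0 tN [_ [->//|]]; rewrite lte_fin => kt.
    have : k.-1%:R * h n < (N * n.+1)%:R * h n by rewrite hK (lt_le_trans kt).
    by rewrite ltr_pM2r// ltr_nat; case: (k).
  rewrite H ?(small _ _ qz.1 z1 ha) ?(small _ _ qz.2 z2 hb)//=.
  by split; apply: in_cell_dist => //; [exact: qz.1|exact: qz.2].
have c1 : (p n).1%:R * h n @[n --> \oo] --> z.1.
  apply: (@squeeze_cvgr _ _ _ _ (fun=> z.1) (fun n => z.1 + h n)).
  - by apply: nearW => n; exact: (pE n).1.
  - exact: cvg_cst.
  - by rewrite -[X in _ --> X]addr0; apply: cvgD => //; exact: cvg_cst.
have c2 : (p n).2%:R * h n @[n --> \oo] --> z.2.
  apply: (@squeeze_cvgr _ _ _ _ (fun=> z.2) (fun n => z.2 + h n)).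
  - by apply: nearW => n; exact: (pE n).2.
  - exact: cvg_cst.
  - by rewrite -[X in _ --> X]addr0; apply: cvgD => //; exact: cvg_cst.
have c3 : f (grid (h n) (p n).1 (p n).2) @[n --> \oo] --> y.
  apply/cvgrPdist_lt => e e0; have [r r0 H] := within_quadrant_delta qz e0.
  near=> n; rewrite -fz; apply: H; first exact: quadrant_grid.
    by near: n; move/cvgrPdist_lt : c1; apply.
  by near: n; move/cvgrPdist_lt : c2; apply.
apply: (cvg_comp _ expR _ (@continuous_expR R _)).
by apply: cvgB; apply: cvgMr => //; exact: cvgM.
Unshelve. all: by end_near. Qed.

(** The endpoint is within one mesh of a point below [z], where [c * f] is at most [c * y]; uniform
    continuity on the square bounds the excess. *)
Let cvg_outside : Num.max (X n) (expR (c * y)) @[n --> \oo] --> expR (c * y).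
Proof.
have u_cvg : Num.max (c * f (grid (h n) (p n).1 (p n).2)) (c * y) @[n --> \oo] --> c * y.
  apply/cvgrPdist_le => e e0.
  pose e' := e / (`|c| + 1).
  have c10 : 0 < `|c| + 1 by rewrite ltr_wpDl.
  have e'0 : 0 < e' by rewrite divr_gt0.
  have := grid_uniform_continuity N%:R e'0; apply: filterS => n H.
  pose g := grid (h n) (p n).1 (p n).2.
  (* The endpoint is only below [z] rounded up; its predecessor in both coordinates is below [z]
     itself, also at index 0 since [0.-1 = 0]. *)
  pose g' := grid (h n) (p n).1.-1 (p n).2.-1.
  have [a ha] := in_cell_exists n qz.1; have [b hb] := in_cell_exists n qz.2.
  have [pa pb _] := p_cell ha hb.
  have /andP[pN1 pN2] := p_box n.
  have near_pred k : `|k%:R * h n - k.-1%:R * h n| <= h n.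
    case: k => [|k] /=; first by rewrite subrr normr0 ltW.
    by rewrite -mulrBl -natrB// subSnn mul1r ger0_norm// ltW.
  have below_z k l t : 0 <= t -> (k <= l)%N -> in_cell (h n) l t%:E -> k.-1%:R * h n <= t.
    move=> t0 kl [_ [l0|]].
      by move: kl; rewrite l0 leqn0 => /eqP ->; rewrite mul0r.
    rewrite lte_fin => /ltW; apply: le_trans; rewrite ler_pM2r// ler_nat.
    by rewrite -!subn1 leq_sub2r.
  have fg' : c * f g' <= c * y.
    apply: f_le; first exact: quadrant_grid.
      exact: below_z qz.1 pa ha.
    exact: below_z qz.2 pb hb.
  have fgg' : `|f g - f g'| <= e'.
    apply: H; [exact: quadrant_grid| | |exact: quadrant_grid|exact: near_pred|exact: near_pred].
      by rewrite /= -(hK n) ler_pM2r// ler_nat.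
    by rewrite /= -(hK n) ler_pM2r// ler_nat.
  have : c * f g <= c * y + e.
    have : c * f g - c * f g' <= e.
      rewrite -mulrBr (le_trans (ler_norm _))// normrM.
      rewrite (@le_trans _ _ (`|c| * e'))//; first by rewrite ler_wpM2l.
      by rewrite /e' mulrA ler_pdivrMr// mulrDr mulr1 mulrC lerDl ltW.
    by move: fg'; lra.
  rewrite -/g; case: (leP (c * f g) (c * y)) => [_ _|]; first by rewrite subrr normr0 ltW.
  by move=> h1 h2; rewrite distrC ger0_norm; lra.
apply: (@squeeze_cvgr _ _ _ _ (fun=> expR (c * y))
   (fun n => expR (Num.max (c * f (grid (h n) (p n).1 (p n).2)) (c * y)))).
- apply: nearW => n; rewrite le_max lexx orbT/= ge_max !ler_expR !le_max lexx orbT andbT.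
  by rewrite lerBlDr lerDl mulr_ge0 ?divr_ge0 ?sqr_ge0// mulr_ge0 ?mulr_ge0 ?(ltW (h0 n)).
- exact: cvg_cst.
- exact: (cvg_comp _ _ u_cvg (@continuous_expR R _)).
Qed.

(** Outside the square only an upper bound is known; the maximum turns it into a convergence, and
    the truncation at [k] keeps the sequence bounded. *)
Lemma cvg_hit_limit k : expR (c * y) <= k ->
  Num.max (Num.min (X n) k) hit_limit @[n --> \oo] --> hit_limit.
Proof.
move=> yk; have Yk := le_trans hit_limit_le yk.
move: hit_limit_le Yk; rewrite /hit_limit; case: ifP => [/andP[z1 z2] _ Yk|_ _ Yk].
  set Y := expR _ in Yk *.
  rewrite -[X in _ --> X](maxxx Y) -{2}(min_l Yk).
  by apply: cvg_max_cst; apply: cvg_min_cst; exact: cvg_inside.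
apply: (@squeeze_cvgr _ _ _ _ (fun=> expR (c * y)) (fun n => Num.max (X n) (expR (c * y)))).
- apply: nearW => n; rewrite le_max lexx orbT/= ge_max !le_max lexx orbT andbT.
  by rewrite ge_min lexx.
- exact: cvg_cst.
- exact: cvg_outside.
Qed.

Lemma cvg_hit_inside k : expR (c * y) <= k -> z.1 <= N%:R -> z.2 <= N%:R ->
  Num.min (X n) k @[n --> \oo] --> hit_limit.
Proof.
move=> yk z1 z2; have Yk := le_trans hit_limit_le yk.
rewrite -[X in _ --> X](min_l Yk) /hit_limit z1 z2/=.
by apply: cvg_min_cst; exact: cvg_inside.
Qed.

End paths.

(** * Expectation of the exponential martingale at the hitting point *)

Section hitting_point.
Context d (T : measurableType d) (R : realType) (P : probability T R).
Variable B : R * R -> {RV P >-> R}.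
Hypothesis cP : measure_is_complete P.
Hypothesis BS : brownian_sheet B.
Variables (y c : R) (tau : {RV P >-> (\bar R * \bar R)%type}).
Hypothesis tau_hit : first_hitting_point B y tau.
Hypothesis c0 : c != 0.
Hypothesis cy : 0 <= c * y.

Let tau_stop : stopping_point B tau. Proof. by case: tau_hit. Qed.

Let tau_ge0 w : (0 <= (tau w).1)%E /\ (0 <= (tau w).2)%E.
Proof. by case: tau_stop => + _; apply. Qed.

Lemma sheet_origin : {ae P, forall w, B (0, 0) w = 0}.
Proof.
have q0 : quadrant (0 : R, 0 : R) by split => /=.
have mB2 : measurable_fun setT (fun w => (B (0, 0) w * B (0, 0) w)%:E).
  by apply/measurable_EFinP; exact: measurable_funM.
have [+ _] := ae_eq_integral_abs P measurableT mB2.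
have -> : (\int[P]_w `|(B (0, 0) w * B (0, 0) w)%:E| = 0)%E.
  under eq_integral do rewrite abse_EFin ger0_norm -?expr2 ?sqr_ge0// expr2.
  by rewrite (integral_sheetM BS)// /sheet_cov/= minxx mul0r.
move=> /(_ erefl); apply: filterS => w /(_ Logic.I) [] /eqP.
by rewrite mulf_eq0 orbb => /eqP.
Qed.

(* Before the hitting point, [c B] cannot cross the level [c y >= 0] since
   along a segment from the origin it starts from [0]. *)
Lemma below_level : {ae P, forall w, exists z,
  [/\ tau w = (z.1%:E, z.2%:E), quadrant z, B z w = y,
      {within @quadrant R, continuous (fun q => B q w)} &
      forall q, quadrant q -> q.1 <= z.1 -> q.2 <= z.2 -> c * B q w <= c * y]}.
Proof.
have [_ hit first] := tau_hit; have [_ _ _ cont] := BS.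
have nice : {ae P, forall w, B (0, 0) w = 0 /\
    {within @quadrant R, continuous (fun q => B q w)}}.
  by apply: filterS2 sheet_origin cont => w; split.
apply: filterS3 hit first nice => w [z tauz Bz] noB [B0 cB]; exists z.
have qz : quadrant z.
  by have [] := tau_ge0 w; rewrite tauz/= !lee_fin; split.
split => // q qq q1 q2; rewrite leNgt; apply/negP => lt_q.
have qnz : q <> z by move=> e; move: lt_q; rewrite e Bz ltxx.
pose g (t : R) := c * B (t * q.1, t * q.2) w.
have cg : {within `[0, 1], continuous g}.
  apply/subspace_continuousP => t /=; rewrite in_itv/= => /andP[t0 t1].
  have qt u : 0 <= u -> quadrant (u * q.1, u * q.2).
    by move=> u0; split; rewrite /= mulr_ge0 ?qq.1 ?qq.2.
  apply/cvgrPdist_lt => e e0.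
  have e'0 : 0 < e / `|c| by rewrite divr_gt0// normr_gt0.
  have [r r0 H] := within_quadrant_delta cB (qt _ t0) e'0.
  have M0 : 0 < q.1 + q.2 + 1.
    by rewrite ltr_wpDl// addr_ge0 ?qq.1 ?qq.2.
  rewrite near_withinE; near=> u => /=; rewrite in_itv/= => /andP[u0 u1].
  have tu : `|t - u| < r / (q.1 + q.2 + 1).
    by near: u; apply: nbhsx_ballx; rewrite divr_gt0.
  have bnd a : 0 <= a -> a <= q.1 + q.2 + 1 -> `|t * a - u * a| < r.
    move=> a0 aM; rewrite -mulrBl normrM (ger0_norm a0).
    apply: (@le_lt_trans _ _ (`|t - u| * (q.1 + q.2 + 1))); first by rewrite ler_wpM2l.
    by rewrite -ltr_pdivlMr.
  rewrite /g -mulrBr normrM mulrC -ltr_pdivlMr ?normr_gt0//.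
  by case: (qq) => a1 a2; apply: H; [exact: qt|apply: bnd => //; lra|apply: bnd => //; lra].
have g0 : g 0 = 0 by rewrite /g !mul0r B0 mulr0.
have g1 : g 1 = c * B q w by rewrite /g !mul1r -surjective_pairing.
have [t] : exists2 t, t \in `[0, 1]%R & g t = c * y.
  apply: IVT => //; rewrite g0 g1 ge_min le_max cy/= (ltW lt_q) orbT//.
rewrite in_itv/= => /andP[t0 t1] /(mulfI c0) Bt.
have t1' a : 0 <= a -> t * a <= a by move=> a0; rewrite ler_piMl.
have qt : quadrant (t * q.1, t * q.2) by split; rewrite /= mulr_ge0 ?qq.1 ?qq.2.
apply: (noB (t * q.1, t * q.2)) Bt => //.
- by rewrite tauz/= lee_fin (le_trans (t1' _ qq.1)).
- by rewrite tauz/= lee_fin (le_trans (t1' _ qq.2)).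
(* If the crossing point were [z], then [z] would be below [q], forcing [q = z]. *)
- rewrite tauz => -[e1 e2]; apply: qnz; rewrite (surjective_pairing q) (surjective_pairing z).
  congr pair; apply/eqP; rewrite eq_le ?q1 ?q2/=.
    by rewrite -e1 t1' ?qq.1.
  by rewrite -e2 t1' ?qq.2.
Unshelve. all: by end_near. Qed.

(** [fine] sends an infinite product to 0, which only concerns a null set since [tau] is almost
    surely finite. *)
Let area w : R := fine ((tau w).1 * (tau w).2)%E.

Let area_ge0 w : 0 <= area w.
Proof. by case: (tau_ge0 w) => h1 h2; rewrite fine_ge0// mule_ge0. Qed.

Let measurable_tau1 : measurable_fun setT (fun w => (tau w).1).
Proof. exact: measurableT_comp. Qed.

Let measurable_tau2 : measurable_fun setT (fun w => (tau w).2).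
Proof. exact: measurableT_comp. Qed.

Definition hit_weight w : R := expR (c * y - c ^+ 2 / 2 * area w).

Lemma hit_weight_ge0 w : 0 <= hit_weight w. Proof. exact: expR_ge0. Qed.

Lemma hit_weight_le w : hit_weight w <= expR (c * y).
Proof. by rewrite ler_expR lerBlDr lerDl mulr_ge0 ?divr_ge0 ?sqr_ge0. Qed.

Lemma measurable_hit_weight : measurable_fun [set: T] hit_weight.
Proof.
apply: measurableT_comp => //; apply: measurable_funB => //; apply: measurable_funM => //.
apply: (measurableT_comp (fine_measurable measurableT)).
exact: emeasurable_funM.
Qed.

Let inside (N : nat) : set T :=
  [set w | ((tau w).1 <= N%:R%:E)%E /\ ((tau w).2 <= N%:R%:E)%E].

Let measurable_inside N : measurable (inside N).
Proof.
have -> : inside N = ((fun w => (tau w).1) @^-1` [set t | (t <= N%:R%:E)%E]) `&`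
    ((fun w => (tau w).2) @^-1` [set t | (t <= N%:R%:E)%E]) by apply/seteqP; split.
rewrite -[X in X `&` _]setTI -[X in _ `&` X]setTI.
by apply: measurableI; exact: emeasurable_fun_infty_c.
Qed.

Let truncated N w : R :=
  hit_weight w * \1_(inside N) w + expR (c * y) * (1 - \1_(inside N) w).

Let truncatedE N w : truncated N w =
  if pselect (inside N w) then hit_weight w else expR (c * y).
Proof.
rewrite /truncated indicE; case: pselect => h.
  by rewrite mem_set// subrr mulr0 addr0 mulr1.
by rewrite memNset// subr0 mulr0 add0r mulr1.
Qed.

Let truncated_ge0 N w : 0 <= truncated N w.
Proof. by rewrite truncatedE; case: pselect => h; exact: expR_ge0. Qed.

Let truncated_le N w : truncated N w <= expR (c * y).
Proof. by rewrite truncatedE; case: pselect => h //; exact: hit_weight_le. Qed.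

Let measurable_truncated N : measurable_fun [set: T] (truncated N).
Proof.
apply: measurable_funD; apply: measurable_funM => //; first exact: measurable_hit_weight.
exact: measurable_funB.
Qed.

(** [X n] is the stopped martingale for the mesh [1 / (n + 1)] and [K = N * (n + 1)], so that the
    square is [[0, N]^2] for every [n]. *)
Let approximation N : exists X : nat -> T -> R,
  [/\ forall n, measurable_fun [set: T] (X n), forall n w, 0 <= X n w,
      forall n, (\int[P]_w (X n w)%:E = 1)%E,
      forall n, (\int[P]_w (X n w ^+ 2)%:E <= (expR (c ^+ 2 * N%:R ^+ 2))%:E)%E &
      forall k, expR (c * y) <= k -> {ae P, forall w,
        Num.max (Num.min (X n w) k) (truncated N w) @[n --> \oo] --> truncated N w /\
        Num.min (X n w) k * \1_(inside N) w @[n --> \oo] -->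
          hit_weight w * \1_(inside N) w}].
Proof.
have h0 n : 0 < n.+1%:R^-1 :> R by rewrite invr_gt0.
have /choice[s hs] := fun n => stopping_path cP BS tau_stop (h0 n) (N * n.+1).
pose X n := stopped (s n) (fun i j => expmart B c (grid n.+1%:R^-1 i j)).
have sb n : forall w, (((s n w).1 <= N * n.+1) && ((s n w).2 <= N * n.+1))%N.
  by have [] := hs n.
have se n : forall i j, augmented_sigma B (below (grid n.+1%:R^-1 i j)) [set w | s n w = (i, j)].
  by have [] := hs n.
exists X; split.
- move=> n; apply: (measurable_stopped cP (sb n) (se n)) => i j.
  exact: measurable_expmart.
- by move=> n w; exact: expR_ge0.
- by move=> n; exact: (integral_stopped_expmart cP BS (h0 n) (sb n) (se n)).
- move=> n; have := integral_stopped_expmart_sqr cP BS (h0 n) (sb n) (se n) c.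
  by rewrite natrM mulfK.
move=> k yk.
have cells : {ae P, forall w n a b, cell tau n.+1%:R^-1 a b w ->
        [/\ ((s n w).1 <= a)%N, ((s n w).2 <= b)%N &
          (a <= N * n.+1)%N -> (b <= N * n.+1)%N -> s n w = (a, b)]}.
  by apply: ae_foralln => n; have [] := hs n.
apply: filterS2 below_level cells => w [z [tauz qz Bz cont lev]] cellw.
have pc n a b : in_cell n.+1%:R^-1 a (z.1)%:E -> in_cell n.+1%:R^-1 b (z.2)%:E ->
  [/\ ((s n w).1 <= a)%N, ((s n w).2 <= b)%N &
     (a <= N * n.+1)%N -> (b <= N * n.+1)%N -> s n w = (a, b)].
  by move=> ha hb; apply: cellw; rewrite /cell/= tauz.
have areaE : area w = z.1 * z.2 by rewrite /area tauz.
have truncE : truncated N w = hit_limit z c y N.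
  rewrite truncatedE /hit_limit /hit_weight areaE /inside/= tauz/=.
  case: pselect => [[h1 h2]|h] /=; first by rewrite !lee_fin in h1 h2; rewrite h1 h2.
  by case: ifP => // /andP[z1 z2]; case: h; rewrite !lee_fin.
split.
  by rewrite truncE; exact: (cvg_hit_limit cont qz Bz lev (fun n => sb n w) pc yk).
rewrite indicE; have [h|h] := pselect (inside N w); last first.
  rewrite memNset// mulr0; under eq_fun do rewrite mulr0; exact: cvg_cst.
rewrite mem_set// mulr1; under eq_fun do rewrite mulr1.
have -> : hit_weight w = hit_limit z c y N.
  by rewrite -truncE truncatedE; case: pselect.
move: h; rewrite /inside/= tauz/= !lee_fin => -[z1 z2].
exact: (cvg_hit_inside cont qz Bz pc yk z1 z2).
Qed.

Let bounded_cvg (g_ : nat -> T -> R) (g : T -> R) (M : R) :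
  (forall n, measurable_fun [set: T] (g_ n)) -> measurable_fun [set: T] g ->
  (forall n w, `|g_ n w| <= M) -> {ae P, forall w, g_ n w @[n --> \oo] --> g w} ->
  (\int[P]_w (g_ n w)%:E @[n --> \oo] --> \int[P]_w (g w)%:E)%E.
Proof.
move=> mg_ mg gM gg.
have [] := @dominated_convergence _ _ _ P setT measurableT
  (fun n w => (g_ n w)%:E) (fun w => (g w)%:E) (fun=> M%:E) => //.
- by move=> n; exact/measurable_EFinP.
- exact/measurable_EFinP.
- apply: filterS gg => w gw _; apply: cvg_EFin; first exact: nearW.
  exact: gw.
- exact: finite_measure_integrable_cst.
- by apply: aeW => w n _; rewrite abse_EFin lee_fin.
Qed.

(** The second moment of [X n] is bounded by a constant [C] for fixed [N], so truncating at a high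
    level [k] loses at most [C / k] of the expectation 1; bounded convergence handles the rest. *)
Let truncated_ge1 N : (1 <= \int[P]_w (truncated N w)%:E)%E.
Proof.
have [X [mX X0 X1 X2 XY]] := approximation N.
apply/lee_addgt0Pr => e e0; set C := expR (c ^+ 2 * N%:R ^+ 2) in X2.
have C0 : 0 < C by exact: expR_gt0.
(* Large enough for [C / k <= e] and for the limits of [approximation]. *)
pose k := expR (c * y) + C / e.
have Ce0 : 0 < C / e by rewrite divr_gt0.
have yk : expR (c * y) <= k by rewrite lerDl ltW.
have k0 : 0 < k by rewrite (lt_le_trans _ yk)// expR_gt0.
pose V n w := Num.max (Num.min (X n w) k) (truncated N w).
have mV n : measurable_fun setT (V n).
  by apply: measurable_maxr => //; exact: measurable_minr.
have V0 n w : 0 <= V n w by rewrite le_max truncated_ge0 orbT.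
have Vk n w : V n w <= k.
  by rewrite ge_max ge_min lexx orbT/= (le_trans (truncated_le _ _)).
have cV := @bounded_cvg V (truncated N) k mV (@measurable_truncated N).
have {}cV : (\int[P]_w (V n w)%:E @[n --> \oo] --> \int[P]_w (truncated N w)%:E)%E.
  apply: cV; first by move=> n w; rewrite ger0_norm.
  by apply: filterS (XY _ yk) => w [].
have V1 n : (1 - e%:E <= \int[P]_w (V n w)%:E)%E.
  rewrite leeBlDr//.
  (* Pointwise [X <= V + X ^+ 2 / k]: [V] dominates [X] when [X <= k], and [X / k > 1] otherwise. *)
  have : (1 <= \int[P]_w ((V n w)%:E + k^-1%:E * (X n w ^+ 2)%:E))%E.
    rewrite -(X1 n); apply: ge0_le_integral => //.
    - by move=> w _; rewrite lee_fin.
    - exact/measurable_EFinP.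
    - apply: emeasurable_funD; first exact/measurable_EFinP.
      by apply: measurable_funeM; apply/measurable_EFinP/measurable_funX.
    - move=> w _; rewrite -EFinM -EFinD lee_fin.
      have [Xk|kX] := leP (X n w) k.
        rewrite (@le_trans _ _ (V n w))//; first by rewrite le_max (min_l Xk) lexx.
        by rewrite lerDl mulr_ge0 ?sqr_ge0// invr_ge0 ltW.
      rewrite -[leLHS]add0r lerD// expr2 mulrA -[leLHS]mul1r ler_wpM2r//.
      by rewrite mulrC ler_pdivlMr// mul1r ltW.
  move=> /le_trans; apply.
  rewrite ge0_integralD//; last 4 first.
  - by move=> w _; rewrite lee_fin.
  - exact/measurable_EFinP.
  - by move=> w _; rewrite mule_ge0// lee_fin ?sqr_ge0// invr_ge0 ltW.
  - by apply: measurable_funeM; apply/measurable_EFinP/measurable_funX.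
  rewrite leeD2l//.
  rewrite ge0_integralZl_EFin//; last 3 first.
  - by move=> w _; rewrite lee_fin sqr_ge0.
  - exact/measurable_EFinP/measurable_funX.
  - by rewrite invr_ge0 ltW.
  apply: (@le_trans _ _ (k^-1%:E * C%:E)%E).
    by rewrite lee_wpmul2l// lee_fin invr_ge0 ltW.
  rewrite -EFinM lee_fin mulrC ler_pdivrMr// mulrDr (mulrC e (C / e)) divfK ?gt_eqF//.
  by rewrite lerDr mulr_ge0// ltW.
rewrite -leeBlDr//; rewrite -(cvg_lim _ cV)//; apply: lime_ge.
  exact: (cvgP _ cV).
exact: nearW.
Qed.

(** The truncated variables restricted to [inside N] are at most [X n], of expectation 1, and
    converge boundedly to the integrand. *)
Let inside_le1 N : (\int[P]_w (hit_weight w * \1_(inside N) w)%:E <= 1)%E.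
Proof.
have [X [mX X0 X1 _ XY]] := approximation N.
pose V n w := Num.min (X n w) (expR (c * y)) * \1_(inside N) w.
have mV n : measurable_fun setT (V n).
  by apply: measurable_funM => //; exact: measurable_minr.
have m0 n w : 0 <= Num.min (X n w) (expR (c * y)) by rewrite le_min X0 expR_ge0.
have V0 n w : 0 <= V n w by rewrite mulr_ge0.
have ind1 w : \1_(inside N) w <= 1 :> R by rewrite indicE; case: (_ \in _).
have cV : (\int[P]_w (V n w)%:E @[n --> \oo] -->
    \int[P]_w (hit_weight w * \1_(inside N) w)%:E)%E.
  apply: (@bounded_cvg _ _ (expR (c * y))) => //.
  - by apply: measurable_funM => //; exact: measurable_hit_weight.
  - move=> n w; rewrite ger0_norm//.
    rewrite (@le_trans _ _ (Num.min (X n w) (expR (c * y))))//.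
      by rewrite ler_piMr.
    by rewrite ge_min lexx orbT.
  - by apply: filterS (XY _ (lexx _)) => w [].
rewrite -(cvg_lim _ cV)//; apply: lime_le; first exact: (cvgP _ cV).
apply: nearW => n; rewrite -(X1 n); apply: ge0_le_integral => //.
- by move=> w _; rewrite lee_fin.
- exact/measurable_EFinP.
- exact/measurable_EFinP.
- move=> w _; rewrite lee_fin (@le_trans _ _ (Num.min (X n w) (expR (c * y))))//.
    by rewrite ler_piMr.
  by rewrite ge_min lexx.
Qed.

(** As [tau] is almost surely finite, [inside N] eventually holds; the lower and upper bounds then
    have the same limit as [N] grows. *)
Lemma integral_hit_weight : (\int[P]_w (hit_weight w)%:E = 1)%E.
Proof.
have ev : {ae P, forall w, \forall N \near \oo, inside N w}.
  apply: filterS below_level => w [z [tauz _ _ _ _]].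
  exists (maxn (Num.truncn z.1).+1 (Num.truncn z.2).+1) => // N /=.
  rewrite geq_max => /andP[N1 N2].
  rewrite /inside/= tauz/= !lee_fin; split; apply/ltW.
    by rewrite (lt_le_trans (truncnS_gt _))// ler_nat.
  by rewrite (lt_le_trans (truncnS_gt _))// ler_nat.
have c1 : (\int[P]_w (truncated N w)%:E @[N --> \oo] --> \int[P]_w (hit_weight w)%:E)%E.
  apply: (@bounded_cvg _ _ (expR (c * y))) => //; first exact: measurable_hit_weight.
    by move=> N w; rewrite ger0_norm.
  apply: filterS ev => w Nw; apply: cvg_near_cst; apply: filterS Nw => N h.
  by rewrite truncatedE; case: pselect.
have c2 : (\int[P]_w (hit_weight w * \1_(inside N) w)%:E @[N --> \oo] -->
    \int[P]_w (hit_weight w)%:E)%E.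
  apply: (@bounded_cvg _ _ (expR (c * y))) => //.
  - by move=> N; apply: measurable_funM => //; exact: measurable_hit_weight.
  - exact: measurable_hit_weight.
  - move=> N w; rewrite normrM ger0_norm ?hit_weight_ge0//.
    rewrite (le_trans _ (hit_weight_le w))// ler_piMr ?hit_weight_ge0//.
    by rewrite indicE; case: (_ \in _); rewrite ?normr1 ?normr0.
  - apply: filterS ev => w Nw; apply: cvg_near_cst; apply: filterS Nw => N h.
    by rewrite indicE mem_set// mulr1.
apply/eqP; rewrite eq_le; apply/andP; split.
  rewrite -(cvg_lim _ c2)//; apply: lime_le; first exact: (cvgP _ c2).
  by apply: nearW.
rewrite -(cvg_lim _ c1)//; apply: lime_ge; first exact: (cvgP _ c1).
by apply: nearW.
Qed.

Lemma laplace_hit_area :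
  (\int[P]_w expeR (- (2^-1 * c ^+ 2)%:E * ((tau w).1 * (tau w).2)) =
    (expR (- (c * y)))%:E)%E.
Proof.
have finite : {ae P, forall w, exists z : R * R, tau w = (z.1%:E, z.2%:E)}.
  by apply: filterS below_level => w [z [tauz _ _ _ _]]; exists z.
pose infinite := [set w | ((tau w).1 * (tau w).2 = +oo)%E].
have minf : measurable infinite.
  rewrite -[infinite]setTI; have mt : measurable_fun setT (fun w => ((tau w).1 * (tau w).2)%E).
    exact: emeasurable_funM.
  exact: (mt measurableT [set +oo%E] (emeasurable_set1 _)).
transitivity (\int[P]_w ((expR (- (c * y)))%:E * (hit_weight w)%:E))%E.
  apply: ae_eq_integral => //.
  (* For measurability, the integrand is written with real values: where the product is infinite,
     [expeR] is 0 whereas [area] is 0, hence the factor [1 - \1_infinite]. *)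
  - have -> : (fun w => expeR (- (2^-1 * c ^+ 2)%:E * ((tau w).1 * (tau w).2))) =
        (fun w => (expR (- (2^-1 * c ^+ 2) * area w) * (1 - \1_infinite w))%:E).
      apply/funext => w; rewrite indicE /area; set t := ((tau w).1 * (tau w).2)%E.
      have : (0 <= t)%E by case: (tau_ge0 w) => h1 h2; exact: mule_ge0.
      case E : t => [r||] // _.
        by rewrite memNset /infinite/= -/t ?E// subr0 mulr1.
      rewrite mem_set /infinite/= -/t ?E// subrr mulr0.
      by rewrite lt0_muley// lte_fin oppr_lt0 mulr_gt0// exprn_even_gt0.
    apply/measurable_EFinP/measurable_funM; last exact: measurable_funB.
    apply: measurableT_comp => //; apply: measurable_funM => //.
    apply: (measurableT_comp (fine_measurable measurableT)).
    exact: emeasurable_funM.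
  - by apply: measurable_funeM; exact/measurable_EFinP/measurable_hit_weight.
  - apply: filterS finite => w [z tauz] _.
    rewrite -EFinM /hit_weight /area tauz /= -expRD; congr (expR _)%:E.
    by field.
rewrite ge0_integralZl_EFin ?expR_ge0//; last 2 first.
- by move=> w _; rewrite lee_fin hit_weight_ge0.
- exact/measurable_EFinP/measurable_hit_weight.
by rewrite integral_hit_weight mule1.
Qed.

End hitting_point.

Theorem proposition4p5 (R : realType) (d : measure_display)
    (T : measurableType d) (P : probability T R)
    (B : R * R -> {RV P >-> R}) (y beta : R)
    (tau : {RV P >-> (\bar R * \bar R)%type}) :
  measure_is_complete P ->
  brownian_sheet B ->
  0 < beta ->
  first_hitting_point B y tau ->
  (\int[P]_w expeR (- (2^-1 * beta ^+ 2)%:E * ((tau w).1 * (tau w).2)) =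
    (expR (- (beta * `|y|)))%:E)%E.
Proof.
(* This sign makes [c * y = beta * |y|] nonnegative, while the left-hand side depends on [c] through
   [c ^+ 2 = beta ^+ 2]. *)
move=> cP BS b0 hit; pose c := if 0 <= y then beta else - beta.
have cyE : c * y = beta * `|y|.
  by rewrite /c; case: ger0P => _ //; rewrite mulNr mulrN.
have c2 : c ^+ 2 = beta ^+ 2 by rewrite /c; case: ifP => _; rewrite ?sqrrN.
have c0 : c != 0.
  by have : 0 < c ^+ 2; [rewrite c2 exprn_gt0|rewrite exprn_even_gt0].
have cy0 : 0 <= c * y by rewrite cyE mulr_ge0// ltW.
by rewrite -cyE -c2; exact: (laplace_hit_area cP BS hit c0 cy0).
Qed.
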